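(* Let $\Omega$ be a $(K,\delta)$-dense sampling scheme, let $M\in\mathbb N$ with $M\le 2K$, let $$\mathcal U_M=\operatorname{span}\{\sqrt M\,\phi(M\cdot-m):m=0,\dots,M-1\},\qquad \phi=\mathbb 1_{[0,1]},$$ and let $\mathcal T\subseteq\mathcal U_M$ be a (nonzero) subspace. Then: (i) if $2K/M\in\mathbb N$, then $C(\Omega,\mathcal T)\le\frac{\pi}{2}\cdot\frac{1+\delta}{1-\delta}$; (ii) if $2K/M\notin\mathbb N$ and $M\ge2$, then $C(\Omega,\mathcal T)\le c_0\frac{1+\delta}{1-\delta}$ with $c_0=\dfrac{1}{\operatorname{sinc}(\pi/2+\pi\delta/M)}$. In particular $c_0\sim\pi/2$ for $M\gg1$.
   Context: For $f\in L^2(\mathbb R)$, $\hat f(\omega)=\int_{\mathbb R}f(x)e^{-2\pi i\omega x}\,dx$; $\langle\cdot,\cdot\rangle$, $\|\cdot\|$ are the $L^2(\mathbb R)$ inner product and norm; $\operatorname{sinc}(x)=\sin(x)/x$. $\mathcal H=\{f\in L^2(\mathbb R):\operatorname{supp}f\subseteq[0,1]\}$. $(K,\delta)$-density: for $K>0$, $0<\delta<1$, a finite set $\Omega=\{\omega_1<\dots<\omega_N\}\subset\mathbb R$ is $(K,\delta)$-dense if $\Omega\subseteq[-K,K]$ and $\max_{n=0,\dots,N}(\omega_{n+1}-\omega_n)\le\delta$, where $\omega_0=\omega_N-2K$, $\omega_{N+1}=\omega_1+2K$. Sampling operator: $\mathcal Sf(x)=\sum_{n=1}^N\mu_n\hat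 f(\omega_n)e^{2\pi i\omega_nx}\mathbb 1_{[0,1]}(x)$, $\mu_n=\tfrac12(\omega_{n+1}-\omega_{n-1})$. $C_1(\Omega,\mathcal T)=\inf_{0\ne f\in\mathcal T}\langle\mathcal Sf,f\rangle/\|f\|^2$, $C_2(\Omega)=\sup_{0\ne f\in\mathcal H}\langle\mathcal Sf,f\rangle/\|f\|^2$, $C(\Omega,\mathcal T)=\sqrt{C_2/C_1}$. *)

(* Defs.v *)
From HB Require Import structures.
From mathcomp Require Import all_boot all_order all_algebra.
From mathcomp Require Import all_classical all_reals all_analysis.
From mathcomp Require Import complex.
Set Implicit Arguments. Unset Strict Implicit. Unset Printing Implicit Defensive.
Import Order.TTheory GRing.Theory Num.Theory.
Import numFieldNormedType.Exports.
Local Open Scope classical_set_scope.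
Local Open Scope ring_scope.

Section Defs.
Variable R : realType.
Local Notation C := (R[i]).
Local Notation mu := (@lebesgue_measure R).

Definition cre (z : C) : R := complex.Re z.
Definition cim (z : C) : R := complex.Im z.
Definition cofR (r : R) : C := Complex r 0.

Definition expi (t : R) : C := Complex (cos t) (sin t).

Definition cint (g : R -> C) : C :=
  Complex (Rintegral mu setT (fun x => cre (g x)))
          (Rintegral mu setT (fun x => cim (g x))).

Definition cabs2 (z : C) : R := cre z ^+ 2 + cim z ^+ 2.

Definition norm2 (f : R -> C) : R := Rintegral mu setT (fun x => cabs2 (f x)).

Definition inner (f g : R -> C) : C := cint (fun x => f x * conjc (g x)).

Definition inL2 (f : R -> C) : Prop :=
  measurable_fun setT (fun x => cre (f x)) /\
  measurable_fun setT (fun x => cim (f x)) /\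
  mu.-integrable setT (fun x => (cabs2 (f x))%:E).

Definition Hspace : set (R -> C) :=
  [set f | inL2 f /\ (forall x, (x < 0 \/ 1 < x) -> f x = 0)].

Definition ind01 (x : R) : R := if (0 <= x) && (x <= 1) then 1 else 0.

Definition fourier (f : R -> C) (w : R) : C :=
  cint (fun x => f x * expi (- (2 * pi * w * x))).

(* A finite sampling set Omega = {w_1 < ... < w_N} is given by N and
   w : nat -> R (only w 1, ..., w N matter).  Extended indices:
   w_0 = w_N - 2K, w_{N+1} = w_1 + 2K. *)
Definition wext (K : R) (N : nat) (w : nat -> R) (n : nat) : R :=
  if n == 0%N then w N - 2 * K
  else if n == N.+1 then w 1%N + 2 * K
  else w n.

Definition Kdelta_dense (K delta : R) (N : nat) (w : nat -> R) : Prop :=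
  0 < K /\ 0 < delta < 1 /\ (0 < N)%N /\
  (forall n : nat, (1 <= n)%N -> (n < N)%N -> w n < w n.+1) /\
  (forall n : nat, (1 <= n <= N)%N -> - K <= w n <= K) /\
  (forall n : nat, (n <= N)%N -> wext K N w n.+1 - wext K N w n <= delta).

Definition weight (K : R) (N : nat) (w : nat -> R) (n : nat) : R :=
  (wext K N w n.+1 - wext K N w n.-1) / 2.

Definition Sop (K : R) (N : nat) (w : nat -> R) (f : R -> C) : R -> C :=
  fun x => \sum_(1 <= n < N.+1)
     cofR (weight K N w n) * fourier f (w n) * expi (2 * pi * w n * x)
       * cofR (ind01 x).

(* Rayleigh quotient <Sf,f>/||f||^2 (the number <Sf,f> is real;
   we take its real part to view it in R) *)
Definition rayleigh (K : R) (N : nat) (w : nat -> R) (f : R -> C) : R :=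
  cre (inner (Sop K N w f) f) / norm2 f.

Definition Cone (K : R) (N : nat) (w : nat -> R) (T : set (R -> C)) : \bar R :=
  ereal_inf [set (rayleigh K N w f)%:E | f in [set f | T f /\ 0 < norm2 f]].

Definition Ctwo (K : R) (N : nat) (w : nat -> R) : \bar R :=
  ereal_sup [set (rayleigh K N w f)%:E | f in [set f | Hspace f /\ 0 < norm2 f]].

(* "C(Omega,T) = sqrt(C_2/C_1) is finite and <= b" *)
Definition Cconst_le (K : R) (N : nat) (w : nat -> R) (T : set (R -> C))
    (b : R) : Prop :=
  (0 < Cone K N w T)%E /\ (Ctwo K N w < +oo)%E /\
  Num.sqrt (fine (Ctwo K N w) / fine (Cone K N w T)) <= b.

Definition UM (M : nat) : set (R -> C) :=
  [set f | exists c : 'I_M -> C, forall x,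
     f x = \sum_(m < M) c m * cofR (Num.sqrt (M%:R) * ind01 (M%:R * x - m%:R))].

Definition nonzero_subspace_of (U T : set (R -> C)) : Prop :=
  T `<=` U /\
  T (fun _ => 0) /\
  (forall f g, T f -> T g -> T (fun x => f x + g x)) /\
  (forall (a : C) f, T f -> T (fun x => a * f x)) /\
  (exists f, T f /\ 0 < norm2 f).

Definition sinc (x : R) : R := sin x / x.

Definition c0 (delta : R) (M : nat) : R := (sinc (pi / 2 + pi * delta / M%:R))^-1.

End Defs.

(* Main.v *)
Require Import Defs.
From HB Require Import structures.
From mathcomp Require Import all_boot all_order all_algebra.
From mathcomp Require Import all_classical all_reals all_analysis.
From mathcomp Require Import measurable_realfun complex.
From mathcomp Require Import ring lra zify.
Set Implicit Arguments. Unset Strict Implicit. Unset Printing Implicit Defensive.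
Import Order.TTheory GRing.Theory Num.Theory.
Import numFieldNormedType.Exports.
Local Open Scope classical_set_scope.
Local Open Scope ring_scope.

(** Write |f^(w)|^2 = |F(w)|^2 with F the transform of f centred at x = 1/2.

    Lower bound: a step function with L cells has |F(w)| = |sinc(pi w / L)| |g(w)| / L
    (up to the limit value at w = 0), where g is a trigonometric polynomial with
    frequencies in [-pi, pi] and |g|^2 is L-periodic.  With a = 1 - delta,
    b = (1 - delta) delta / pi^2 and H' = a |g|^2 - b |g'|^2, the increment of H over a
    period is at least L (1 - delta)^2 ||g||^2, while over an arm of length t <= delta/2
    ending at a sample point x it is at most t |g(x)|^2: this is a Riccati comparison
    with a tangent, and needs the Becker-Stark bound (1 - 4x^2/pi^2) tan x <= x.
    When 2K is not a multiple of M, the cells of the samples in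
    [-M/2 - delta, M/2 + delta] may cover slightly more than a period; the overlap
    is removed either by cutting at a sample point or by adding two Riccati profiles
    of opposite signs.

    Upper bound: the same comparison with H' = (1 + delta) |F|^2 +
    (1 + delta) delta / pi^2 |F'|^2 and a rational profile, where the total increment of
    H is controlled by averaging Bessel's inequality over the grids b + Z. *)

(** * Rules for real derivatives and comparison by the mean value theorem *)

Section RealDerivatives.
Context {R : realType}.
Implicit Types (f g df : R -> R) (a b x y t : R).

Lemma der_cst a x : is_derive x 1 (fun _ : R => a) (0 : R).
Proof. exact: is_derive_cst. Qed.

Lemma der_id x : is_derive x 1 (fun t : R => t) (1 : R).
Proof. exact: is_derive_id. Qed.

Lemma derD f g x (a b : R) : is_derive x 1 f a -> is_derive x 1 g b ->
  is_derive x 1 (fun t => f t + g t) (a + b).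
Proof. by move=> fa gb; exact: is_deriveD. Qed.

Lemma derN f x (a : R) : is_derive x 1 f a -> is_derive x 1 (fun t => - f t) (- a).
Proof. by move=> fa; exact: is_deriveN. Qed.

Lemma derM f g x (a b : R) : is_derive x 1 f a -> is_derive x 1 g b ->
  is_derive x 1 (fun t => f t * g t) (a * g x + f x * b).
Proof.
move=> fa gb; have := is_deriveM fa gb.
by congr is_derive; rewrite /GRing.scale /= addrC [a * g x]mulrC.
Qed.

Lemma derX f x (a : R) n : is_derive x 1 f a ->
  is_derive x 1 (fun t => f t ^+ n.+1) (n.+1%:R * f x ^+ n * a).
Proof. by move=> /(is_deriveX n.+1); rewrite exprfctE. Qed.

Lemma derV f x (a : R) : f x != 0 -> is_derive x 1 f a ->
  is_derive x 1 (fun t => (f t)^-1) (- (f x) ^- 2 * a).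
Proof. by move=> fx0 fa; apply: (is_derive_eq (is_deriveV fx0 fa)). Qed.

Lemma der_comp f g x (a b : R) : is_derive (g x) 1 f a -> is_derive x 1 g b ->
  is_derive x 1 (fun t => f (g t)) (b * a).
Proof. by move=> fa gb; rewrite mulrC; exact: is_derive1_comp. Qed.

Lemma der_sin f x (a : R) : is_derive x 1 f a ->
  is_derive x 1 (fun t => sin (f t)) (a * cos (f x)).
Proof. by move=> fa; apply: der_comp. Qed.

Lemma der_cos f x (a : R) : is_derive x 1 f a ->
  is_derive x 1 (fun t => cos (f t)) (- (a * sin (f x))).
Proof. by move=> fa; rewrite -mulrN; apply: der_comp. Qed.

Lemma der_tan f x (a : R) : cos (f x) != 0 -> is_derive x 1 f a ->
  is_derive x 1 (fun t => tan (f t)) (a * (cos (f x)) ^- 2).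
Proof. by move=> c0 fa; apply: der_comp; exact: is_derive_tan. Qed.

Lemma der_sum (I : Type) (r : seq I) (f df : I -> R -> R) x :
  (forall i, is_derive x 1 (f i) (df i x)) ->
  is_derive x 1 (fun t => \sum_(i <- r) f i t) (\sum_(i <- r) df i x).
Proof.
move=> fdf; elim: r => [|i r IHr].
  under eq_fun do rewrite big_nil; rewrite big_nil; exact: der_cst.
under eq_fun do rewrite big_cons; rewrite big_cons; exact: derD.
Qed.

Lemma der_eq f x (a b : R) : is_derive x 1 f a -> a = b -> is_derive x 1 f b.
Proof. by move=> fa <-. Qed.

Lemma der_continuous f x (a : R) : is_derive x 1 f a -> {for x, continuous f}.
Proof. by move=> [fx _]; exact/differentiable_continuous/derivable1_diffP. Qed.

Lemma der_mvt f df a b : a <= b ->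
  (forall x, a <= x <= b -> is_derive x 1 f (df x)) ->
  exists2 c, a <= c <= b & f b - f a = df c * (b - a).
Proof.
move=> ab fdf.
have [||c cab fE] := @MVT_segment R f df a b ab.
- by move=> x; rewrite in_itv /= => /andP[ax xb]; apply: fdf; rewrite !ltW.
- apply: continuous_in_subspaceT => x; rewrite inE /= in_itv /= => xab.
  exact: (der_continuous (fdf x xab)).
- by exists c => //; move: cab; rewrite in_itv.
Qed.

Lemma der_ge0_le f df a b : a <= b ->
  (forall x, a <= x <= b -> is_derive x 1 f (df x)) ->
  (forall x, a <= x <= b -> 0 <= df x) -> f a <= f b.
Proof.
move=> ab fdf df0; have [c cab fE] := der_mvt ab fdf.
by rewrite -subr_ge0 fE mulr_ge0 ?subr_ge0 ?df0.
Qed.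

Lemma der_le f g df dg a b : a <= b ->
  (forall x, a <= x <= b -> is_derive x 1 f (df x)) ->
  (forall x, a <= x <= b -> is_derive x 1 g (dg x)) ->
  (forall x, a <= x <= b -> df x <= dg x) -> f b - f a <= g b - g a.
Proof.
move=> ab fdf gdg dfg.
have := @der_ge0_le (fun t => g t + - f t) (fun t => dg t + - df t) a b ab.
have h (x : R) : a <= x <= b -> is_derive x 1 (fun t => g t + - f t) (dg x + - df x).
  by move=> xab; apply: derD; [exact: gdg|apply: derN; exact: fdf].
move=> /(_ h); have dge x : a <= x <= b -> 0 <= dg x + - df x.
  by move=> /dfg; rewrite subr_ge0.
move=> /(_ dge); lra.
Qed.

End RealDerivatives.

(* [is_derive] is a class: instance search must be kept from filling the
   premises with its own, differently shaped, derivatives. *)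
Ltac der := repeat first [ notypeclasses refine (der_id _)
  | notypeclasses refine (der_cst _ _) | notypeclasses refine (derX _ _)
  | notypeclasses refine (derN _) | notypeclasses refine (derD _ _)
  | notypeclasses refine (derM _ _) | notypeclasses refine (der_sin _)
  | notypeclasses refine (der_cos _) ].

Ltac dereq := notypeclasses refine (der_eq _ _); [der|cbv beta].

(** * Inequalities for sine, cosine, sinc and pi *)

Section Trigonometry.
Context {R : realType}.
Implicit Types (x y : R).

(** Starting from [cos <= 1], this bound and the next three arise by integrating the preceding one
    from 0. *)
Lemma sin_le_id x : 0 <= x -> sin x <= x.
Proof.
move=> x0; have /= := @der_le R sin (fun t => t) cos (fun=> 1) 0 x x0.
rewrite sin0 !subr0 => h; apply: h => t _; exact: cos_le1.
Qed.

Lemma cos_ge_taylor2 x : 0 <= x -> 1 - x ^+ 2 / 2 <= cos x.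
Proof.
move=> x0; have := @der_le R (fun t => - cos t) (fun t => t ^+ 2 * 2^-1)
  sin (fun t => t) 0 x x0.
rewrite cos0 expr0n /= mul0r subr0 => h.
suff : - cos x - -1 <= x ^+ 2 / 2 by lra.
apply: h => t /andP[t0 _].
- by dereq; lra.
- by dereq; lra.
- exact: sin_le_id.
Qed.

Lemma sin_ge_taylor3 x : 0 <= x -> x - x ^+ 3 / 6 <= sin x.
Proof.
move=> x0; have := @der_le R (fun t => t - t ^+ 3 * 6^-1) sin
  (fun t => 1 - t ^+ 2 / 2) cos 0 x x0.
rewrite sin0 expr0n /= mul0r !subr0; apply => t /andP[t0 _].
- by dereq; lra.
- exact: cos_ge_taylor2.
Qed.

Lemma cos_le_taylor4 x : 0 <= x -> cos x <= 1 - x ^+ 2 / 2 + x ^+ 4 / 24.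
Proof.
move=> x0; have := @der_le R (fun t => t ^+ 2 * 2^-1 - t ^+ 4 * 24^-1)
  (fun t => - cos t) (fun t => t - t ^+ 3 / 6) sin 0 x x0.
rewrite cos0 !expr0n /= !mul0r !subr0 => h.
suff : x ^+ 2 / 2 - x ^+ 4 / 24 <= - cos x - -1 by lra.
apply: h => t /andP[t0 _].
- by dereq; lra.
- by dereq; lra.
- exact: sin_ge_taylor3.
Qed.

Lemma pi_sqr_ge8 : 8 <= (pi : R) ^+ 2.
Proof.
have /cos_ge_taylor2 : 0 <= (pi : R) / 2 by have := pi_gt0 R; lra.
by rewrite cos_pihalf; lra.
Qed.

(** The quartic bound gives cos (sqrt 3) <= 1 - 3/2 + 9/24 < 0, so sqrt 3 cannot lie below pi/2. *)
Lemma pi_sqr_le12 : (pi : R) ^+ 2 <= 12.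
Proof.
have p0 := pi_gt0 R; have s0 : 0 <= Num.sqrt (3 : R) by exact: sqrtr_ge0.
have s2 : Num.sqrt (3 : R) ^+ 2 = 3 by rewrite sqr_sqrtr.
have [|ps] := leP (pi / 2) (Num.sqrt (3 : R)).
  by move=> h; nra.
have /ltW c0 : 0 < cos (Num.sqrt (3 : R)).
  by apply: cos_gt0_pihalf; apply/andP; split => //; lra.
have := cos_le_taylor4 s0.
have -> : Num.sqrt (3 : R) ^+ 4 = 9 by rewrite (exprM _ 2 2) s2; lra.
by rewrite s2; lra.
Qed.

Lemma xcos_le_sin x : 0 <= x <= pi -> x * cos x <= sin x.
Proof.
move=> /andP[x0 xpi].
have := @der_ge0_le R (fun t => sin t - t * cos t) (fun t => t * sin t) 0 x x0.
rewrite sin0 mul0r subr0 subr_ge0; apply => t /andP[t0 tx].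
  by dereq; lra.
by rewrite mulr_ge0// sin_ge0_pi// t0 (le_trans tx).
Qed.

(** Monotonicity of sinc on [0, pi], cross-multiplied so that x = 0 is covered as well. *)
Lemma sinc_cross_le x y : 0 <= x -> x <= y -> y <= pi -> x * sin y <= y * sin x.
Proof.
move=> x0 xy ypi.
have [->|xN0] := eqVneq x 0; first by rewrite sin0 mulr0 mul0r.
have {x0 xN0} x0 : 0 < x by rewrite lt_def xN0.
have := @der_le R (fun t => sin t * t^-1) (fun _ => 0)
  (fun t => (cos t * t - sin t) / t ^+ 2) (fun _ => 0) x y xy.
move=> h; suff : sin y / y - sin x / x <= 0 - 0.
  rewrite subrr subr_le0 ler_pdivrMr ?(lt_le_trans x0)// mulrAC.
  by rewrite ler_pdivlMr// mulrC [leRHS]mulrC.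
apply: h => t /andP[xt ty].
- have t0 : t != 0 by rewrite gt_eqF// (lt_le_trans x0).
  notypeclasses refine (der_eq _ _).
    by notypeclasses refine (derM _ _); [der|notypeclasses refine (derV _ _); [|der]].
  by cbv beta; field.
- have t0 : 0 < t by rewrite (lt_le_trans x0).
  rewrite ler_pdivrMr ?exprn_gt0// mul0r subr_le0 mulrC xcos_le_sin//.
  by rewrite (ltW t0) (le_trans ty).
Qed.

Lemma sinc_ge x y : 0 < y -> `|x| <= y -> y <= pi -> x != 0 -> sinc y <= sinc x.
Proof.
move=> y0 xy ypi xN0; have x0 : 0 < `|x| by rewrite normr_gt0.
suff : sinc y <= sinc `|x|.
  have [x0'|x0'] := leP 0 x; first by rewrite ger0_norm.
  by rewrite ltr0_norm// {2}/sinc sinN invrN mulrNN.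
have := sinc_cross_le (ltW x0) xy ypi.
by rewrite /sinc ler_pdivrMr// mulrAC ler_pdivlMr// mulrC [leRHS]mulrC.
Qed.

(* The derivative is x * (4/pi^2 x cos x - (1 - 8/pi^2) sin x); as (tan x)/x
   increases, it changes sign once, from + to -, and the function vanishes at
   both ends. *)
Lemma becker_stark x : 0 <= x <= pi / 2 ->
  (1 - 4 * x ^+ 2 / pi ^+ 2) * sin x <= x * cos x.
Proof.
move=> /andP[x0 xpi]; have p0 := pi_gt0 R.
have p20 : (pi : R) ^+ 2 != 0 by rewrite expf_neq0// gt_eqF.
have p21 : (pi : R) ^+ 2 * pi ^- 2 = 1 by rewrite mulfV.
have q0 : 0 < (pi : R) ^- 2 by rewrite invr_gt0 exprn_gt0.
set q := (pi : R) ^- 2 in p21 q0.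
have k0 : 0 <= 1 - 8 * q.
  by rewrite -[X in X - _]p21 -mulrBl mulr_ge0 ?subr_ge0 ?pi_sqr_ge8// ltW.
pose phi t : R := t * cos t - (1 - 4 * t ^+ 2 * q) * sin t.
pose psi t : R := 4 * q * (t * cos t) - (1 - 8 * q) * sin t.
have dphi (t : R) : is_derive t 1 phi (t * psi t).
  by rewrite /phi; dereq; rewrite /psi; lra.
have phi0 : phi 0 = 0 by rewrite /phi mul0r sin0; lra.
have phi1 : phi (pi / 2) = 0.
  rewrite /phi cos_pihalf sin_pihalf mulr0 mulr1 expr_div_n.
  have -> : 4 * (pi ^+ 2 / 2 ^+ 2) * q = pi ^+ 2 * q by lra.
  by rewrite p21; lra.
(* If [phi] were negative at [x], the mean value theorem on both sides of [x] would give s <= t with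
   [psi s < 0 < psi t], the wrong order of signs. *)
rewrite -subr_ge0 -/(phi x) leNgt; apply/negP => phix.
have [s /andP[s0 sx]] := der_mvt x0 (fun t _ => dphi t).
rewrite phi0 !subr0 => sE.
have [t /andP[xt tp]] := der_mvt xpi (fun t _ => dphi t).
rewrite phi1 sub0r => tE.
have psis : psi s < 0.
  rewrite ltNge; apply/negP => h; have : 0 <= s * psi s * x by rewrite !mulr_ge0.
  by rewrite -sE leNgt phix.
have psit : 0 < psi t.
  rewrite ltNge; apply/negP => h.
  have : t * psi t * (pi / 2 - x) <= 0.
    by rewrite mulr_le0_ge0 ?subr_ge0// mulr_ge0_le0 ?(le_trans x0).
  by rewrite -tE; lra.
have st := le_trans sx xt.
have cs : 0 <= cos s by apply: cos_ge0_pihalf; apply/andP; split; lra.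
have ct : 0 <= cos t by apply: cos_ge0_pihalf; apply/andP; split; lra.
(* This is (tan s)/s <= (tan t)/t; it is the monotonicity of sinc between t - s and t + s, expanded
   by the addition formulas. *)
have key : t * cos t * sin s <= s * cos s * sin t.
  have := @sinc_cross_le (t - s) (t + s); rewrite sinB sinD => h.
  by have := h ltac:(lra) ltac:(lra) ltac:(lra); nra.
have ss : 0 <= sin s by apply: sin_ge0_pi; apply/andP; split; lra.
have xgt0 : 0 < x.
  by rewrite lt_def x0 andbT; apply: contraPneq phix => ->; rewrite phi0 ltxx.
have st0 : 0 < sin t by apply: sin_gt0_pi; apply/andP; split; lra.
have h1 : 4 * q * (s * cos s) * sin t < (1 - 8 * q) * sin s * sin t.
  by rewrite ltr_pM2r//; move: psis; rewrite /psi; lra.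
have h2 : (1 - 8 * q) * sin t * sin s <= 4 * q * (t * cos t) * sin s.
  by rewrite ler_wpM2r//; move: psit; rewrite /psi; lra.
have h3 : 4 * q * (t * cos t * sin s) <= 4 * q * (s * cos s * sin t).
  by rewrite ler_wpM2l//; lra.
lra.
Qed.

End Trigonometry.

(** * Riccati comparison on the arms of a sample *)

Section Riccati.
Context {R : realType}.
Implicit Types (x y c t : R).

(* Completing squares, (V |g|^2)' - a |g|^2 + b |g'|^2 is at least
   |V g + b g'|^2 / b for a supersolution V of the Riccati equation. *)
Lemma riccati_growth (H u v du dv V dV : R -> R) (a b x y : R) :
  x <= y -> 0 < b ->
  (forall t, x <= t <= y -> is_derive t 1 u (du t)) ->
  (forall t, x <= t <= y -> is_derive t 1 v (dv t)) ->
  (forall t, x <= t <= y -> is_derive t 1 V (dV t)) ->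
  (forall t, x <= t <= y -> is_derive t 1 H
     (a * (u t ^+ 2 + v t ^+ 2) - b * (du t ^+ 2 + dv t ^+ 2))) ->
  (forall t, x <= t <= y -> a + V t ^+ 2 / b <= dV t) ->
  H y - H x <= V y * (u y ^+ 2 + v y ^+ 2) - V x * (u x ^+ 2 + v x ^+ 2).
Proof.
move=> xy b0 uE vE VE HE dVge.
apply: (@der_le _ _ (fun t => V t * (u t ^+ 2 + v t ^+ 2)) _
  (fun t => dV t * (u t ^+ 2 + v t ^+ 2) +
            V t * (2 * u t * du t + 2 * v t * dv t)) x y xy HE) => t txy.
  notypeclasses refine (der_eq _ _).
    notypeclasses refine (derM (VE t txy) _).
    notypeclasses refine (derD _ _); notypeclasses refine (derX _ _).
      exact: uE. exact: vE.
  by rewrite /= !expr1.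
have := dVge t txy; set g := u t ^+ 2 + v t ^+ 2 => dVg.
have g0 : 0 <= g by rewrite addr_ge0 ?sqr_ge0.
have : (a + V t ^+ 2 / b) * g <= dV t * g by rewrite ler_wpM2r.
suff : 0 <= V t ^+ 2 / b * g + V t * (2 * u t * du t + 2 * v t * dv t) +
   b * (du t ^+ 2 + dv t ^+ 2) by lra.
have -> : V t ^+ 2 / b * g + V t * (2 * u t * du t + 2 * v t * dv t) +
   b * (du t ^+ 2 + dv t ^+ 2) =
   ((V t * u t + b * du t) ^+ 2 + (V t * v t + b * dv t) ^+ 2) / b.
  by rewrite /g; field; rewrite gt_eqF.
by rewrite divr_ge0 ?(ltW b0)// addr_ge0 ?sqr_ge0.
Qed.

(* Supersolutions of the Riccati equation r' = a + r^2 / b. *)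
Definition arm_profile (a b h : R) (r dr : R -> R) :=
  [/\ forall t, r (- t) = - r t,
      forall t, - h <= t <= h -> is_derive t 1 r (dr t),
      forall t, - h <= t <= h -> a + r t ^+ 2 / b <= dr t,
      forall t, 0 <= t <= h -> 0 <= r t &
      forall t, 0 <= t <= h -> r t <= t].

Section Arms.
Variables (H u v du dv r dr : R -> R) (a b h : R).
Hypotheses (a0 : 0 <= a) (b0 : 0 < b).
Hypothesis uE : forall t, is_derive t 1 u (du t).
Hypothesis vE : forall t, is_derive t 1 v (dv t).
Hypothesis HE : forall t, is_derive t 1 H
     (a * (u t ^+ 2 + v t ^+ 2) - b * (du t ^+ 2 + dv t ^+ 2)).
Hypothesis rP : arm_profile a b h r dr.
Let G t := u t ^+ 2 + v t ^+ 2.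

Let G0 t : 0 <= G t. Proof. by rewrite addr_ge0 ?sqr_ge0. Qed.

Let r0 : r 0 = 0.
Proof. by have [rN _ _ _ _] := rP; have := rN 0; rewrite oppr0; lra. Qed.

Let der_shift c t : - h <= t - c <= h ->
  is_derive t 1 (fun s => r (s - c)) (dr (t - c)).
Proof.
have [_ rE _ _ _] := rP => tc; notypeclasses refine (der_eq _ _).
  notypeclasses refine (der_comp (g := fun s => s - c) (rE _ tc) _); der.
by rewrite addr0 mul1r.
Qed.

Let single c x y : x <= y -> - h <= x - c -> y - c <= h ->
  H y - H x <= r (y - c) * G y - r (x - c) * G x.
Proof.
move=> xy xc yc; have [_ _ rR _ _] := rP.
apply: (@riccati_growth H u v du dv (fun s => r (s - c)) (fun s => dr (s - c)) a b)
  => // t /andP[xt ty].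
- by apply: der_shift; apply/andP; split; lra.
- by apply: rR; apply/andP; split; lra.
Qed.

(** The profile is centred at the free end [c] of the arm, where it vanishes; only the sample point
    [y] contributes, and there [r t <= t]. *)
Lemma right_arm c y : c <= y -> y - c <= h -> H y - H c <= (y - c) * G y.
Proof.
move=> cy yc; have [_ _ _ _ rle] := rP.
have h0 : 0 <= y - c by lra.
have := @single c c y cy; rewrite subrr r0 mul0r subr0 => /(_ _ _)/le_trans-> //.
  lra.
by rewrite ler_wpM2r// rle// h0.
Qed.

Lemma left_arm x c : x <= c -> c - x <= h -> H c - H x <= (c - x) * G x.
Proof.
move=> xc cx; have [rN _ _ _ rle] := rP.
have h0 : 0 <= c - x by lra.
have := @single c x c xc; rewrite subrr r0 mul0r sub0r -opprB rN mulNr opprK.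
move=> /(_ _ _)/le_trans-> //; [lra|lra|].
by rewrite ler_wpM2r// rle// h0.
Qed.

(* On [x, y] the two profiles have opposite signs, so their sum is again a
   supersolution; this pays for overlapping arms of two samples. *)
Lemma double_arm c1 x y c2 : c1 <= x -> x <= y -> y <= c2 ->
  y - c1 <= h -> c2 - x <= h ->
  H c2 - H c1 <= (y - c1) * G y + (c2 - x) * G x.
Proof.
move=> c1x xy yc2 yc1 c2x; have [rN rE rR rge rle] := rP.
have s1 : H x - H c1 <= r (x - c1) * G x.
  by have := @single c1 c1 x c1x; rewrite subrr r0 mul0r subr0; apply; lra.
have s3 : H c2 - H y <= r (c2 - y) * G y.
  have := @single c2 y c2 yc2; rewrite subrr r0 mul0r sub0r -opprB rN mulNr opprK.
  by apply; lra.
have s2 : H y - H x <= (r (y - c1) + r (y - c2)) * G y -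
    (r (x - c1) + r (x - c2)) * G x.
  apply: (@riccati_growth H u v du dv (fun s => r (s - c1) + r (s - c2))
    (fun s => dr (s - c1) + dr (s - c2)) a b) => // t /andP[xt ty].
    notypeclasses refine (derD _ _); apply: der_shift; apply/andP; split; lra.
  have h1 : - h <= t - c1 <= h by apply/andP; split; lra.
  have h2 : - h <= t - c2 <= h by apply/andP; split; lra.
  have := rR _ h1; have := rR _ h2.
  have p1 : 0 <= r (t - c1) by apply: rge; apply/andP; split; lra.
  have p2 : r (t - c2) <= 0.
    by rewrite -opprB rN oppr_le0; apply: rge; apply/andP; split; lra.
  have : (r (t - c1) + r (t - c2)) ^+ 2 / b <=
    r (t - c1) ^+ 2 / b + r (t - c2) ^+ 2 / b.
    rewrite -mulrDl ler_pM2r ?invr_gt0//.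
    by have := mulr_ge0_le0 p1 p2; rewrite sqrrD; lra.
  move: a0; rewrite /=; lra.
have e1 : r (y - c2) = - r (c2 - y) by rewrite -opprB rN.
have e2 : r (x - c2) = - r (c2 - x) by rewrite -opprB rN.
have l1 : r (y - c1) * G y <= (y - c1) * G y.
  by rewrite ler_wpM2r// rle//; apply/andP; split; lra.
have l2 : r (c2 - x) * G x <= (c2 - x) * G x.
  by rewrite ler_wpM2r// rle//; apply/andP; split; lra.
move: s2; rewrite e1 e2; lra.
Qed.

End Arms.

End Riccati.

(** Index arithmetic: hypotheses with real inequalities or sums are cleared before [lia] runs. *)
Ltac nlia := repeat match goal with
  | H : context [@Order.le] |- _ => clear H
  | H : context [@Order.lt] |- _ => clear H
  | H : context [@GRing.add] |- _ => clear H
  end; lia.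

(** * Covering one period by the cells of the samples *)

Section PeriodCovering.
Context {R : realType}.
Variables (G H : R -> R) (h M P : R) (w : nat -> R).
Hypothesis G0 : forall t, 0 <= G t.
Hypothesis GM : forall t, G (t + M) = G t.
Hypothesis HM : forall t, H (t + M) = H t + P.
Hypothesis M0 : 0 < M.
Hypothesis rarm : forall c y : R, c <= y -> y - c <= h -> H y - H c <= (y - c) * G y.
Hypothesis larm : forall x c : R, x <= c -> c - x <= h -> H c - H x <= (c - x) * G x.
Hypothesis darm : forall c1 x y c2 : R, c1 <= x -> x <= y -> y <= c2 ->
  y - c1 <= h -> c2 - x <= h -> H c2 - H c1 <= (y - c1) * G y + (c2 - x) * G x.

(** The cell of the sample [w n.+1] is [[z n, z n.+1]], whose length is the quadrature weight of
    that sample; hence the index shift in [F]. *)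
Definition midpoint (n : nat) : R := (w n + w n.+1) / 2.
Local Notation z := midpoint.
Let F n := (z n.+1 - z n) * G (w n.+1).

Section Range.
Variables (p q : nat).
Hypothesis wS : forall n, (p <= n <= q)%N -> w n <= w n.+1.
Hypothesis wh : forall n, (p <= n <= q)%N -> w n.+1 - w n <= 2 * h.

Let zw n : (p <= n <= q)%N -> [/\ w n <= z n, z n <= w n.+1, z n - w n <= h & w n.+1 - z n <= h].
Proof. by move=> pn; have := wS pn; have := wh pn; rewrite /z; split; lra. Qed.

(** Each cell is cut at its sample into a right arm and a left arm, and the increments telescope. *)
Let cells m n : (p <= m <= n)%N -> (n <= q)%N ->
  H (z n) - H (z m) <= \sum_(m <= k < n) F k.
Proof.
move=> /andP[pm]; elim: n => [|n IHn].
  by rewrite leqn0 => /eqP-> _; rewrite big_geq// subrr.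
rewrite leq_eqVlt => /predU1P[<- _|]; first by rewrite big_geq// subrr.
rewrite ltnS => mn nq; rewrite big_nat_recr//=.
have [_ h1 _ h2] := @zw n ltac:(nlia); have [h3 _ h4 _] := @zw n.+1 ltac:(nlia).
have := IHn mn (ltnW nq); have := rarm h1 h2; have := larm h3 h4.
rewrite /F; lra.
Qed.

Let zmono m n : (p <= m <= n)%N -> (n <= q)%N -> z m <= z n.
Proof.
move=> /andP[pm]; elim: n => [|n IHn].
  by rewrite leqn0 => /eqP->.
rewrite leq_eqVlt => /predU1P[<- _//|]; rewrite ltnS => mn nq.
have [_ h1 _ _] := @zw n ltac:(nlia); have [h2 _ _ _] := @zw n.+1 ltac:(nlia).
by apply: le_trans (IHn mn (ltnW nq)) _; exact: le_trans h1 h2.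
Qed.

Let F0 n : (p <= n < q)%N -> 0 <= F n.
Proof.
move=> pn; have [_ h1 _ _] := @zw n ltac:(nlia).
have [h2 _ _ _] := @zw n.+1 ltac:(nlia).
by rewrite mulr_ge0//; lra.
Qed.

Let F_sum0 m n : (p <= m)%N -> (n <= q)%N -> 0 <= \sum_(m <= k < n) F k.
Proof.
move=> pm nq; rewrite big_nat_cond sumr_ge0// => k; rewrite andbT => kmn.
by apply: F0; nlia.
Qed.

(** Here [q0] is the first cell to reach the end of the period that starts at [z p]; only this cell
    can stick out. *)
Let tight_cover q0 : (p <= q0 < q)%N -> z q0 < z p + M -> z p + M <= z q0.+1 ->
  P <= \sum_(p <= k < q0.+1) F k.
Proof.
move=> /andP[pq0 q0q] zlt zge; have Mgt0 := M0.
have [_ a1 _ a2] := @zw q0 ltac:(nlia).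
have [a3 _ a4 _] := @zw q0.+1 ltac:(nlia).
have ra := rarm a1 a2.
(* If the last sample lies within the period, its left arm is just truncated at [z p + M]. *)
have [wle|wgt] := leP (w q0.+1) (z p + M).
  have la : H (z p + M) - H (w q0.+1) <= (z p + M - w q0.+1) * G (w q0.+1).
    by apply: larm => //; lra.
  have : (z p + M - w q0.+1) * G (w q0.+1) <= (z q0.+1 - w q0.+1) * G (w q0.+1).
    by rewrite ler_wpM2r//; lra.
  have ce := @cells p q0 ltac:(nlia) ltac:(nlia).
  rewrite big_nat_recr//=; move: la ra ce; rewrite HM /F; lra.
(* Otherwise the last sample is translated back by one period to [y], and [i] below is the index of
   the cell that contains [y]. *)
set y := w q0.+1 - M.
have yG : G y = G (w q0.+1) by rewrite -(GM y) /y subrK.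
have yH : H (w q0.+1) = H y + P by rewrite -(HM y) /y subrK.
have cH : H (z q0) = H (z q0 - M) + P by rewrite -(HM (z q0 - M)) subrK.
have zpy : z p < y by rewrite /y; lra.
have exi : exists i, (p <= i)%N && (y <= z i).
  by exists q0.+1; rewrite leqW//= /y; lra.
case: (ex_minnP exi) => -[|i] /andP[lepi yi] imin.
  by move: lepi zpy; rewrite leqn0 => /eqP->; rewrite ltNge yi.
have iq : (i <= q0)%N.
  by rewrite -ltnS; apply: imin; rewrite leqW//= /y; lra.
have pNi : p != i.+1.
  by apply/eqP => piE; move: yi; rewrite -piE leNgt zpy.
have {lepi pNi} lepi : (p <= i)%N by rewrite -ltnS ltn_neqAle pNi.
have ziy : z i < y.
  by rewrite ltNge; apply/negP => h'; have := imin i; rewrite lepi h' ltnn => /(_ isT).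
have [_ b1 _ b2] := @zw i ltac:(nlia).
have [b3 _ b4 _] := @zw i.+1 ltac:(nlia).
(* When [y] precedes the sample of its cell, the period is cut at a sample point: it runs from [y]
   to [w q0.+1], and what lies outside contributes nonnegatively. *)
have [wy|yw] := leP y (w i.+1).
  have ry : H (w i.+1) - H y <= (w i.+1 - y) * G (w i.+1) by apply: rarm; lra.
  have ry' : (w i.+1 - y) * G (w i.+1) <= (w i.+1 - z i) * G (w i.+1).
    by rewrite ler_wpM2r//; lra.
  have [iq0|q0i] := ltnP i q0; last first.
    have iE : i = q0 by nlia.
    have := @F_sum0 p q0 (leqnn _) ltac:(nlia).
    have wz : 0 <= (z q0.+1 - w q0.+1) * G (w q0.+1) by rewrite mulr_ge0//; lra.
    by rewrite big_nat_recr//=; move: ry ry' wz; rewrite iE /F; lra.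
  have lz : H (z i.+1) - H (w i.+1) <= (z i.+1 - w i.+1) * G (w i.+1).
    exact: larm.
  have ce := @cells i.+1 q0 ltac:(nlia) ltac:(nlia).
  have c0 := @F_sum0 p i (leqnn _) ltac:(nlia).
  have wz : 0 <= (z q0.+1 - w q0.+1) * G (w q0.+1) by rewrite mulr_ge0//; lra.
  rewrite big_nat_recr//= (big_cat_nat _ (n := i)) /=; [|nlia|nlia].
  rewrite [X in _ <= _ + X + _]big_ltn//.
  move: ry ry' lz ce c0 wz ra; rewrite /F; lra.
have iq0 : (i < q0)%N.
  rewrite ltn_neqAle iq andbT; apply: contraTneq yw => ->.
  by rewrite -leNgt /y; lra.
have zpw : z p <= w i.+1.
  apply: le_trans b1; have := @zmono p i; rewrite leqnn lepi => /(_ isT); apply.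
  by nlia.
(* When [y] follows that sample, the left arm of [w i.+1] overlaps the translated right arm of
   [w q0.+1]. The period used is [z q0 - M, z q0]: the double arm covers it up to [z i.+1], whole
   cells cover the rest. *)
have d := @darm (z q0 - M) (w i.+1) y (z i.+1) ltac:(lra) (ltW yw) yi
  ltac:(rewrite /y; lra) ltac:(lra).
rewrite yG in d.
have ce := @cells i.+1 q0 ltac:(nlia) ltac:(nlia).
have c0 := @F_sum0 p i (leqnn _) ltac:(nlia).
have wz : 0 <= (z q0.+1 - w q0.+1) * G (w q0.+1) by rewrite mulr_ge0//; lra.
have wz' : 0 <= (w i.+1 - z i) * G (w i.+1) by rewrite mulr_ge0//; lra.
rewrite big_nat_recr//= (big_cat_nat _ (n := i)) /=; [|nlia|nlia].
rewrite [X in _ <= _ + X + _]big_ltn//.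
move: d ce c0 wz wz'; rewrite /F /y; lra.
Qed.

Lemma period_le_cells : (p <= q)%N -> z p + M <= z q ->
  P <= \sum_(p <= k < q) F k.
Proof.
move=> pq zpq; have Mgt0 := M0.
have ex : exists n, (p <= n)%N && (z p + M <= z n) by exists q; rewrite pq.
case: (ex_minnP ex) => -[|n] /andP[pn zn] nmin.
  by move: pn zn; rewrite leqn0 => /eqP->; lra.
have nq : (n.+1 <= q)%N by apply: nmin; rewrite pq.
have pNn : p != n.+1 by apply/eqP => pE; move: zn; rewrite -pE; lra.
have {pn pNn} pn : (p <= n)%N by rewrite -ltnS ltn_neqAle pNn.
have zlt : z n < z p + M.
  by rewrite ltNge; apply/negP => h'; have := nmin n; rewrite pn h' ltnn => /(_ isT).
have h1 := @tight_cover n ltac:(nlia) zlt zn.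
rewrite (big_cat_nat _ (n := n.+1)) /=; [|nlia|nlia].
by rewrite (le_trans h1)// lerDl F_sum0//; nlia.
Qed.

End Range.
End PeriodCovering.

(* [field] unfolds [pi], so it is generalized beforehand. *)
Ltac gen_pi := match goal with |- context [@pi ?R] =>
  let h := fresh "pN1" in have h := lt0r_neq0 (pi_gt0 R);
  move: h; generalize (@pi R) => ? h end.

(** * The tangent profile for the lower bound *)

Section TangentProfile.
Context {R : realType}.

(** This tangent solves r' = a + r^2 / b exactly. With x = pi t / sqrt delta and t <= delta / 2 one
    has 4 x^2 / pi^2 <= delta, so the Becker-Stark bound gives (1 - delta) tan x <= x, that is,
    [r t <= t]. *)
Lemma tan_arm_profile (delta : R) : 0 < delta < 1 ->
  let s := Num.sqrt delta in
  arm_profile (1 - delta) ((1 - delta) * delta / pi ^+ 2) (delta / 2)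
    (fun t => (1 - delta) * s / pi * tan (pi / s * t))
    (fun t => (1 - delta) * cos (pi / s * t) ^- 2).
Proof.
move=> /andP[d0 d1] s; have p0 := pi_gt0 R.
have s2 : s ^+ 2 = delta by rewrite sqr_sqrtr// ltW.
have s0 : 0 < s by rewrite sqrtr_gt0.
have s1 : s < 1 by rewrite -(@ltr_pXn2r _ 2) ?nnegrE ?(ltW s0)// s2 expr1n.
have pN0 : (pi : R) != 0 by rewrite gt_eqF.
have sN0 : s != 0 by rewrite gt_eqF.
have dN0 : delta != 0 by rewrite gt_eqF.
have aN0 : 1 - delta != 0 by rewrite gt_eqF// subr_gt0.
have ls0 : 0 <= pi / s by rewrite divr_ge0// ltW.
have xle t : t <= delta / 2 -> pi / s * t <= pi / 2 * s.
  move=> td; have -> : pi / 2 * s = pi / s * (delta / 2) by rewrite -s2; gen_pi; field.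
  by rewrite ler_pM2l// divr_gt0.
have xlt t : t <= delta / 2 -> pi / s * t < pi / 2.
  move=> /xle/le_lt_trans; apply; nra.
have cgt0 t : - (delta / 2) <= t <= delta / 2 -> 0 < cos (pi / s * t).
  move=> /andP[lt tl]; apply: cos_gt0_pihalf; rewrite xlt// andbT.
  by have := @xlt (- t) ltac:(lra); rewrite mulrN; lra.
split => t.
- by rewrite mulrN tanN mulrN.
- move=> /cgt0 c0; notypeclasses refine (der_eq _ _).
    notypeclasses refine (derM (der_cst _ _) (der_tan _ _)).
      by rewrite gt_eqF.
    by notypeclasses refine (derM (der_cst _ _) (der_id _)).
  by rewrite /=; have := lt0r_neq0 c0; gen_pi => cN0; field; rewrite sN0 pN1 cN0.
- move=> /cgt0 c0; rewrite cos2_tan2 ?gt_eqF//.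
  rewrite le_eqVlt; apply/orP; left; apply/eqP; move: (tan _) aN0 => T.
  by rewrite -s2; gen_pi => aN0; field; rewrite sN0 pN1 aN0.
- move=> /andP[t0 td]; have c0 : 0 < cos (pi / s * t) by apply: cgt0; apply/andP; split; lra.
  rewrite mulr_ge0//; first by rewrite divr_ge0 ?mulr_ge0 ?subr_ge0 ?ltW.
  rewrite /tan divr_ge0 ?(ltW c0)// sin_ge0_pi//.
  apply/andP; split; first by rewrite mulr_ge0.
  by have := xlt _ td; lra.
- move=> /andP[t0 td]; have c0 : 0 < cos (pi / s * t) by apply: cgt0; apply/andP; split; lra.
  set x := pi / s * t in c0 *.
  have x0 : 0 <= x by rewrite mulr_ge0.
  have xp : x < pi / 2 by exact: xlt.
  have sx0 : 0 <= sin x by apply: sin_ge0_pi; apply/andP; split; lra.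
  have xs : 4 * x ^+ 2 / pi ^+ 2 <= delta.
    have : x ^+ 2 <= (pi / 2 * s) ^+ 2.
      by rewrite ler_pXn2r ?nnegrE//; [exact: xle|nra].
    by rewrite ler_pdivrMr ?exprn_gt0// !exprMn s2; lra.
  have := @becker_stark R x; rewrite x0 ltW// => /(_ isT) bs.
  have : (1 - delta) * sin x <= x * cos x by apply: le_trans bs; nra.
  have tE : t = s / pi * x by rewrite /x; gen_pi; field; rewrite sN0 pN1.
  rewrite -ler_pdivrMr// => le1; rewrite [leRHS]tE /tan.
  have -> : (1 - delta) * s / pi * (sin x / cos x) =
    s / pi * ((1 - delta) * sin x / cos x) by gen_pi; field; rewrite pN1 gt_eqF.
  by rewrite ler_pM2l// divr_gt0.
Qed.

End TangentProfile.

(** * Plane rotations as real and imaginary parts *)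

Section Rotations.
Context {R : realType}.
Implicit Types (x y t : R).

Lemma sinD2pin x (j k : nat) : sin (x + (j%:R - k%:R) * (2 * pi)) = sin x.
Proof.
have per n y : sin (y + n%:R * (2 * pi)) = sin y.
  have -> : y + n%:R * (2 * pi) = y + pi *+ 2 *+ n.
    by rewrite !mulr_natl.
  exact: periodicn (@sinD2pi R) n y.
rewrite -(per k) -[in RHS](per j); congr sin; lra.
Qed.

Lemma cosD2pin x (j k : nat) : cos (x + (j%:R - k%:R) * (2 * pi)) = cos x.
Proof. by rewrite -!sinDpihalf addrAC sinD2pin. Qed.

(* With c = p + i q, these are the real and imaginary parts of c e^(-i x). *)
Definition rotre (p q x : R) := p * cos x + q * sin x.
Definition rotim (p q x : R) := q * cos x - p * sin x.

Lemma rot_inner (p q p' q' x y : R) :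
  rotre p q x * rotre p' q' y + rotim p q x * rotim p' q' y =
  (p * p' + q * q') * cos (x - y) + (q * p' - p * q') * sin (x - y).
Proof. by rewrite /rotre /rotim cosB sinB; ring. Qed.

Lemma der_rotre (p q th t : R) :
  is_derive t 1 (fun s => rotre p q (th * s)) (th * rotim p q (th * t)).
Proof. by rewrite /rotre; dereq; rewrite /rotim; ring. Qed.

Lemma der_rotim (p q th t : R) :
  is_derive t 1 (fun s => rotim p q (th * s)) (- (th * rotre p q (th * t))).
Proof. by rewrite /rotim; dereq; rewrite /rotre; ring. Qed.

End Rotations.

(** * Trigonometric polynomials and their sampling inequality *)

Section TrigPolynomial.
Context {R : realType}.
Variables (L : nat) (p q : 'I_L -> R).
Hypothesis L0 : (0 < L)%N.
Implicit Types (t : R) (j k : 'I_L).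

(** The centred phase 2 pi x - pi at the midpoint of the j-th cell of [0, 1]. With c_j = p_j + i
    q_j, the next definitions are the real and imaginary parts of g(t) = sum_j c_j e^(-i freq_j t)
    and of g'. *)
Definition freq j : R := 2 * pi * (j%:R + 2^-1) / L%:R - pi.
Definition trigre t := \sum_j rotre (p j) (q j) (freq j * t).
Definition trigim t := \sum_j rotim (p j) (q j) (freq j * t).
Definition dtrigre t := \sum_j freq j * rotim (p j) (q j) (freq j * t).
Definition dtrigim t := \sum_j - (freq j * rotre (p j) (q j) (freq j * t)).
Definition energy := \sum_j (p j ^+ 2 + q j ^+ 2).

Let LR : (L%:R : R) != 0. Proof. by rewrite pnatr_eq0 -lt0n. Qed.
Let LR0 : 0 < (L%:R : R). Proof. by rewrite ltr0n. Qed.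

Lemma freqB j k : (freq j - freq k) * L%:R = (j%:R - k%:R) * (2 * pi).
Proof. by rewrite /freq; gen_pi; field. Qed.

Lemma freq_sqr_le j : freq j ^+ 2 <= pi ^+ 2.
Proof.
have p0 := pi_gt0 R; have LR0' := LR0.
rewrite -ler_sqrt ?exprn_ge0 ?(ltW p0)// !sqrtr_sqr (ger0_norm (ltW p0)).
have jL : (j%:R + 2^-1 : R) <= L%:R.
  have : ((j.+1)%:R : R) <= L%:R by rewrite ler_nat.
  by rewrite -natr1; lra.
have j0 : (0 : R) <= j%:R by rewrite ler0n.
have h0 : (0 : R) <= 2 * pi * (j%:R + 2^-1) / L%:R.
  apply: divr_ge0; last exact: ltW.
  by apply: mulr_ge0; lra.
have h1 : (2 : R) * pi * (j%:R + 2^-1) / L%:R <= 2 * pi.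
  by rewrite ler_pdivrMr// ler_pM2l//; lra.
by rewrite ler_norml /freq; apply/andP; split; lra.
Qed.

Lemma der_trigre t : is_derive t 1 trigre (dtrigre t).
Proof.
exact: (@der_sum R 'I_L _ (fun j s => rotre (p j) (q j) (freq j * s))
  (fun j s => freq j * rotim (p j) (q j) (freq j * s)) t (fun j => der_rotre _ _ _ _)).
Qed.

Lemma der_trigim t : is_derive t 1 trigim (dtrigim t).
Proof.
exact: (@der_sum R 'I_L _ (fun j s => rotim (p j) (q j) (freq j * s))
  (fun j s => - (freq j * rotre (p j) (q j) (freq j * s))) t (fun j => der_rotim _ _ _ _)).
Qed.

(** Real part of the j-th term of g times the conjugate of the k-th. Only the difference of the
    frequencies enters, so |g|^2 is [L]-periodic even where g is not. *)
Let cross j k t := rotre (p j) (q j) (freq j * t) * rotre (p k) (q k) (freq k * t) +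
  rotim (p j) (q j) (freq j * t) * rotim (p k) (q k) (freq k * t).

Let crossE j k t : cross j k t =
  (p j * p k + q j * q k) * cos ((freq j - freq k) * t) +
  (q j * p k - p j * q k) * sin ((freq j - freq k) * t).
Proof. by rewrite /cross rot_inner [(freq j - freq k) * t]mulrBl. Qed.

Let shiftE j k t : (freq j - freq k) * (t + L%:R) =
  (freq j - freq k) * t + (j%:R - k%:R) * (2 * pi).
Proof. by rewrite mulrDr freqB. Qed.

Let normE t : trigre t ^+ 2 + trigim t ^+ 2 = \sum_j \sum_k cross j k t.
Proof.
rewrite !expr2 !big_distrlr /= -big_split; apply: eq_bigr => j _.
by rewrite -big_split.
Qed.

Let dnormE t : dtrigre t ^+ 2 + dtrigim t ^+ 2 =
  \sum_j \sum_k freq j * freq k * cross j k t.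
Proof.
rewrite !expr2 !big_distrlr /= -big_split; apply: eq_bigr => j _.
rewrite -big_split; apply: eq_bigr => k _; rewrite /= /cross; ring.
Qed.

Lemma trig_norm_periodic t :
  trigre (t + L%:R) ^+ 2 + trigim (t + L%:R) ^+ 2 = trigre t ^+ 2 + trigim t ^+ 2.
Proof.
rewrite !normE; apply: eq_bigr => j _; apply: eq_bigr => k _.
by rewrite !crossE !shiftE sinD2pin cosD2pin.
Qed.

Section Antiderivative.
Variables (a b : R).

Let prim j k t := if j == k then (p j ^+ 2 + q j ^+ 2) * t
  else ((p j * p k + q j * q k) * sin ((freq j - freq k) * t) -
        (q j * p k - p j * q k) * cos ((freq j - freq k) * t)) / (freq j - freq k).

Definition trig_primitive t :=
  \sum_j \sum_k (a - b * (freq j * freq k)) * prim j k t.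

Let der_prim j k t : is_derive t 1 (prim j k) (cross j k t).
Proof.
rewrite crossE /prim; case: eqVneq => [->|jk].
  rewrite subrr; dereq; rewrite mul0r cos0 sin0; ring.
have fN0 : freq j - freq k != 0.
  apply: contra_neq jk => f0; apply/val_inj/eqP; rewrite -(eqr_nat R) -subr_eq0.
  have := freqB j k; rewrite f0 mul0r => /esym/eqP; rewrite mulf_eq0 => /orP[//|].
  by have := pi_gt0 R; rewrite mulf_eq0 => /lt0r_neq0/negbTE->; rewrite pnatr_eq0.
by dereq; field.
Qed.

Lemma der_trig_primitive t : is_derive t 1 trig_primitive
  (a * (trigre t ^+ 2 + trigim t ^+ 2) - b * (dtrigre t ^+ 2 + dtrigim t ^+ 2)).
Proof.
have -> : a * (trigre t ^+ 2 + trigim t ^+ 2) -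
    b * (dtrigre t ^+ 2 + dtrigim t ^+ 2) =
    \sum_j \sum_k (a - b * (freq j * freq k)) * cross j k t.
  rewrite normE dnormE !mulr_sumr -sumrB; apply: eq_bigr => j _.
  rewrite !mulr_sumr -sumrB; apply: eq_bigr => k _; ring.
apply: (@der_sum R 'I_L (index_enum _)
  (fun j s => \sum_k (a - b * (freq j * freq k)) * prim j k s)
  (fun j s => \sum_k (a - b * (freq j * freq k)) * cross j k s)) => j.
apply: (@der_sum R 'I_L (index_enum _)
  (fun k s => (a - b * (freq j * freq k)) * prim j k s)
  (fun k s => (a - b * (freq j * freq k)) * cross j k s)) => k.
notypeclasses refine (der_eq _ _).
  by notypeclasses refine (derM (der_cst _ _) (der_prim _ _ _)).
by rewrite mul0r add0r.
Qed.

(** The off-diagonal primitives are periodic; only the diagonal ones, linear in t, grow. *)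
Lemma trig_primitive_period t : trig_primitive (t + L%:R) =
  trig_primitive t + L%:R * \sum_j (a - b * freq j ^+ 2) * (p j ^+ 2 + q j ^+ 2).
Proof.
rewrite mulr_sumr -big_split; apply: eq_bigr => j _ /=.
rewrite (bigD1 j)//= [in RHS](bigD1 j)//= /prim eqxx.
have -> : \sum_(k < L | k != j) (a - b * (freq j * freq k)) * prim j k (t + L%:R) =
    \sum_(k < L | k != j) (a - b * (freq j * freq k)) * prim j k t.
  apply: eq_bigr => k kj; congr (_ * _).
  by rewrite /prim eq_sym (negbTE kj) shiftE sinD2pin cosD2pin.
rewrite /prim; ring.
Qed.

End Antiderivative.

Lemma trig_sampling_lower (delta : R) (w : nat -> R) (m n : nat) :
  0 < delta < 1 -> (m <= n)%N ->
  (forall i, (m <= i <= n)%N -> w i <= w i.+1) ->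
  (forall i, (m <= i <= n)%N -> w i.+1 - w i <= delta) ->
  midpoint w m + L%:R <= midpoint w n ->
  L%:R * (1 - delta) ^+ 2 * energy <=
  \sum_(m <= i < n) (midpoint w i.+1 - midpoint w i) *
    (trigre (w i.+1) ^+ 2 + trigim (w i.+1) ^+ 2).
Proof.
move=> d01 mn wS wd zmn; have /andP[d0 d1] := d01.
have p0 := pi_gt0 R; have p20 : 0 < (pi : R) ^+ 2 by rewrite exprn_gt0.
have a0 : 0 < 1 - delta by rewrite subr_gt0.
pose a := 1 - delta; pose b : R := (1 - delta) * delta / pi ^+ 2.
have b0 : 0 < b by rewrite divr_gt0// mulr_gt0.
have rP := tan_arm_profile d01.
(* The value of [b] is such that a - b freq_j^2 >= a - b pi^2 = (1 - delta)^2, which bounds the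
   increment over a period from below. *)
apply: (@le_trans _ _
  (L%:R * \sum_j (a - b * freq j ^+ 2) * (p j ^+ 2 + q j ^+ 2))).
  rewrite -mulrA ler_pM2l// mulr_sumr ler_sum// => j _.
  rewrite ler_wpM2r ?addr_ge0 ?sqr_ge0//.
  have : b * freq j ^+ 2 <= b * pi ^+ 2 by rewrite ler_pM2l// freq_sqr_le.
  have -> : b * pi ^+ 2 = (1 - delta) * delta by rewrite /b mulfVK ?gt_eqF.
  by rewrite /a; lra.
have G0 t : 0 <= trigre t ^+ 2 + trigim t ^+ 2 by rewrite addr_ge0 ?sqr_ge0.
have dH := der_trig_primitive a b.
apply: (@period_le_cells R (fun t => trigre t ^+ 2 + trigim t ^+ 2)
  (trig_primitive a b) (delta / 2) L%:R) => //.
- exact: trig_norm_periodic.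
- exact: trig_primitive_period.
- exact: (right_arm b0 der_trigre der_trigim dH rP).
- exact: (left_arm b0 der_trigre der_trigim dH rP).
- exact: (double_arm (ltW a0) b0 der_trigre der_trigim dH rP).
- by move=> i /wd; lra.
Qed.

End TrigPolynomial.

(** * Integrals with their values *)

Section HasIntegral.
Context {R : realType}.
Local Notation mu := (@lebesgue_measure R).
Implicit Types (D : set (measurableTypeR R)) (f g : R -> R) (a b c I J : R).

(** Integrability travels with the value, since [Rintegral] is total and its value alone does not
    entail it. *)
Definition has_integral D g I :=
  mu.-integrable D (EFin \o g) /\ Rintegral mu D g = I.

Lemma has_integral_ext D f g I : (forall x, D x -> f x = g x) ->
  measurable D -> has_integral D f I -> has_integral D g I.
Proof.
move=> fg mD [fi <-]; split.
  by apply: eq_integrable fi => // x /set_mem Dx /=; rewrite fg.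
by apply/esym/eq_Rintegral => x /set_mem Dx; exact: fg.
Qed.

Lemma has_integralD D f g I J : measurable D -> has_integral D f I ->
  has_integral D g J -> has_integral D (fun x => f x + g x) (I + J).
Proof.
move=> mD [fi <-] [gi <-]; split; last by rewrite RintegralD.
have := @integrableD _ _ _ mu D mD _ _ fi gi; apply: eq_integrable => // x _ /=.
Qed.

Lemma has_integralZ D f I c : measurable D -> has_integral D f I ->
  has_integral D (fun x => c * f x) (c * I).
Proof.
move=> mD [fi <-]; split; last by rewrite RintegralZl.
have := @integrableZl _ _ _ mu D mD c _ fi; apply: eq_integrable => // x _ /=.
Qed.

Lemma has_integral0 D : measurable D -> has_integral D (fun=> 0) 0.
Proof.
move=> mD; split; last by rewrite Rintegral_cst// mul0r.
exact: integrable0.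
Qed.

Lemma has_integral_sum D (T : Type) (r : seq T) (f : T -> R -> R) (I : T -> R) :
  measurable D -> (forall i, has_integral D (f i) (I i)) ->
  has_integral D (fun x => \sum_(i <- r) f i x) (\sum_(i <- r) I i).
Proof.
move=> mD fI; elim: r => [|i r IHr].
  under eq_fun do rewrite big_nil; rewrite big_nil; exact: has_integral0.
under eq_fun do rewrite big_cons; rewrite big_cons; exact: has_integralD.
Qed.

Lemma has_integral_le D f g I J : measurable D -> has_integral D f I ->
  has_integral D g J -> (forall x, D x -> f x <= g x) -> I <= J.
Proof. by move=> mD [fi <-] [gi <-]; exact: (@le_Rintegral _ _ _ mu). Qed.

Lemma has_integral_itv (P g : R -> R) a b : a < b -> continuous g ->
  (forall x : R, is_derive x 1 P (g x)) -> has_integral `[a, b] g (P b - P a).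
Proof.
move=> ab cg dP; split.
  apply: continuous_compact_integrable; first exact: segment_compact.
  exact: continuous_subspaceT.
rewrite /Rintegral (@continuous_FTC2 _ g P)//.
- exact: continuous_subspaceT.
- split.
  + by move=> x _; apply: ex_derive; exact: dP.
  + by apply: cvg_at_right_filter; apply: (der_continuous (dP a)).
  + by apply: cvg_at_left_filter; apply: (der_continuous (dP b)).
- by move=> x _; rewrite derive1E; apply: derive_val.
Qed.

Lemma has_integral_setT D g I : measurable D ->
  (forall x, ~ D x -> g x = 0) -> has_integral D g I -> Rintegral mu setT g = I.
Proof.
move=> mD g0 [_ <-]; rewrite [RHS]Rintegral_mkcond; congr (Rintegral _ _ _).
apply/funext => x; rewrite patchE; case: ifPn => // /negP xD.
by apply: g0 => Dx; apply: xD; exact: mem_set.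
Qed.

End HasIntegral.

(** * Square-integrable functions on [0, 1] *)

Section SquareIntegrable.
Context {R : realType}.
Local Notation mu := (@lebesgue_measure R).
Local Notation D := (`[0, 1]%classic : set (measurableTypeR R)).
Implicit Types (h k m : R -> R).

Let mD : measurable D. Proof. exact: measurable_itv. Qed.

(** [h] and [k] stand for the real and imaginary parts of a single function, [N] for its squared
    norm. *)
Definition sqint h k (N : R) := [/\ measurable_fun D h, measurable_fun D k &
  has_integral D (fun x => h x ^+ 2 + k x ^+ 2) N].

(** Domination by 1 + h^2 + k^2, integrable because [0, 1] has finite measure. *)
Lemma sqint_integrable h k N : sqint h k N ->
  mu.-integrable D (EFin \o h) /\ mu.-integrable D (EFin \o k).
Proof.
move=> [mh mk [hk _]].
have one : mu.-integrable D (EFin \o (fun _ : R => 1 : R)).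
  apply: continuous_compact_integrable; first exact: segment_compact.
  by apply: continuous_subspaceT => x; exact: cst_continuous.
have hk1 := @integrableD _ _ _ mu D mD _ _ one hk.
split; apply: (@le_integrable _ _ _ mu D mD _ _ _ _ hk1).
- exact/measurable_EFinP.
- move=> x _; rewrite /= lee_fin; apply: le_trans (ler_norm _).
  have := sqr_ge0 (k x); have := sqr_ge0 (`|h x| - 1).
  rewrite -[h x ^+ 2]real_normK ?num_real//; have := normr_ge0 (h x); nra.
- exact/measurable_EFinP.
- move=> x _; rewrite /= lee_fin; apply: le_trans (ler_norm _).
  have := sqr_ge0 (h x); have := sqr_ge0 (`|k x| - 1).
  rewrite -[k x ^+ 2]real_normK ?num_real//; have := normr_ge0 (k x); nra.
Qed.

Let cont_measurable m : continuous m -> measurable_fun D m.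
Proof. by move=> cm; apply: measurable_funTS; exact: continuous_measurable_fun. Qed.

Let cont_bounded m : continuous m -> exists2 c, 0 <= c & forall x, D x -> `|m x| <= c.
Proof.
move=> cm; have [] := @compact_bounded _ _ (m @` D).
  apply: continuous_compact; first exact: continuous_subspaceT.
  exact: segment_compact.
move=> c [cr cm']; exists (`|c| + 1); first by rewrite addr_ge0.
move=> x Dx; apply: (cm' (`|c| + 1)); last by exists x.
by rewrite (le_lt_trans (ler_norm _))// ltrDl.
Qed.

Lemma integrable_mul_cont h m : continuous m -> mu.-integrable D (EFin \o h) ->
  mu.-integrable D (EFin \o (fun x => h x * m x)).
Proof.
move=> cm hi; have [c c0 mc] := cont_bounded cm.
have H := @integrableMl _ _ _ mu D mD _ _ hi (cont_measurable cm).
have {}H : mu.-integrable D (fun x => (h x)%:E * (m x)%:E)%E.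
  apply: H; exists c; split; first exact: num_real.
  by move=> d cd x Dx; exact: le_trans (mc x Dx) (ltW cd).
by apply: eq_integrable H.
Qed.

Lemma sqint_mul h k m N : sqint h k N -> continuous m ->
  exists N', sqint (fun x => m x * h x) (fun x => m x * k x) N'.
Proof.
move=> [mh mk [hk _]] cm.
eexists; split; first by apply: measurable_funM => //; exact: cont_measurable.
  by apply: measurable_funM => //; exact: cont_measurable.
split; last by reflexivity.
have cm2 : continuous (fun x => m x * m x).
  by move=> x; apply: continuousM; exact: cm.
have := integrable_mul_cont cm2 hk; apply: eq_integrable => // x _ /=.
by rewrite !exprMn -mulrDr mulrC expr2.
Qed.

End SquareIntegrable.

(** * The Fourier transform, its derivative and Bessel's inequality *)

Section Transform.
Context {R : realType}.
Local Notation mu := (@lebesgue_measure R).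
Local Notation D := (`[0, 1]%classic : set (measurableTypeR R)).
Implicit Types (h k m : R -> R) (w : R).

Let mD : measurable D. Proof. exact: measurable_itv. Qed.

Lemma rotimZ (c p q x : R) : rotim (c * p) (c * q) x = c * rotim p q x.
Proof. by rewrite /rotim; ring. Qed.

(** A rotation moves to the other side of the inner product of the plane as its inverse. *)
Lemma rot_adjoint (p q a b y : R) :
  p * rotre a b (- y) + q * rotim a b (- y) = a * rotre p q y + b * rotim p q y.
Proof. by rewrite /rotre /rotim sinN cosN; ring. Qed.

Lemma rot_norm_le (p q y : R) : `|rotre p q y| <= `|p| + `|q|.
Proof.
apply: (le_trans (ler_normD _ _)); rewrite !normrM lerD// ler_piMr//.
  exact: cos_max.
exact: sin_max.
Qed.

(** Multiplication by -i turns imaginary parts into real parts; facts on [ftim] are thus reduced to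
    facts on [ftre]. *)
Lemma rotimE (p q y : R) : rotim p q y = rotre q (- p) y.
Proof. by rewrite /rotim /rotre; ring. Qed.

(** Real part of the integral of (h + i k) e^(-i m w). The phase [m] is a parameter because both 2
    pi x and its centred version occur. *)
Definition ftre m h k w := Rintegral mu D (fun x => rotre (h x) (k x) (m x * w)).
Definition ftim m h k w := Rintegral mu D (fun x => rotim (h x) (k x) (m x * w)).

Lemma ftimE m h k w : ftim m h k w = ftre m k (fun x => - h x) w.
Proof. by apply: eq_Rintegral => x _; rewrite rotimE. Qed.

Lemma sqint_swap h k N : sqint h k N -> sqint k (fun x => - h x) N.
Proof.
move=> [mh mk hk]; split => //.
  exact: measurableT_comp.
apply: has_integral_ext hk => // x _; rewrite sqrrN; exact: addrC.
Qed.

Let cos_cont m w : continuous m -> continuous (fun x => cos (m x * w)).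
Proof.
move=> cm x; apply: continuous_comp; last exact: continuous_cos.
by apply: continuousM; [exact: cm|exact: cst_continuous].
Qed.

Let sin_cont m w : continuous m -> continuous (fun x => sin (m x * w)).
Proof.
move=> cm x; apply: continuous_comp; last exact: continuous_sin.
by apply: continuousM; [exact: cm|exact: cst_continuous].
Qed.

Lemma has_integral_ftre h k m N w : sqint h k N -> continuous m ->
  has_integral D (fun x => rotre (h x) (k x) (m x * w)) (ftre m h k w).
Proof.
move=> /sqint_integrable[hi ki] cm; split; last by [].
have h1 := integrable_mul_cont (@cos_cont _ w cm) hi.
have h2 := integrable_mul_cont (@sin_cont _ w cm) ki.
by have := @integrableD _ _ _ mu D mD _ _ h1 h2; apply: eq_integrable.
Qed.

Lemma has_integral_ftim h k m N w : sqint h k N -> continuous m ->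
  has_integral D (fun x => rotim (h x) (k x) (m x * w)) (ftim m h k w).
Proof.
move=> /sqint_swap/has_integral_ftre => /[apply] => /(_ w); rewrite ftimE.
by apply: has_integral_ext => // x _; rewrite rotimE.
Qed.

Lemma der_integral (f df : R -> R -> R) (g : R -> R) w :
  (forall x t : R, is_derive t 1 (f ^~ x) (df t x)) ->
  (forall t, mu.-integrable D (EFin \o f t)) ->
  mu.-integrable D (EFin \o g) -> (forall x, 0 <= g x) ->
  (forall t x, D x -> `|df t x| <= g x) ->
  is_derive w 1 (fun t => Rintegral mu D (f t)) (Rintegral mu D (df w)).
Proof.
move=> fdf fi gi g0 dfg.
(* Differentiation under the integral is local in t; the domination by [g] is global, so any
   neighbourhood of [w] serves. *)
have wI : `]w - 1, w + 1[%classic w.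
  by rewrite /= in_itv /=; apply/andP; split; lra.
have dE t x : partial1of2 f t x = df t x.
  by rewrite partial1of2E; apply: derive_val.
have df1 (t x : R) : `]w - 1, w + 1[%classic t -> D x -> derivable (f ^~ x) t 1.
  by move=> _ _; apply: ex_derive; exact: fdf.
have ub t x : `]w - 1, w + 1[%classic t -> D x -> `|partial1of2 f t x| <= g x.
  by move=> _ Dx; rewrite dE; exact: dfg.
have d1 := @derivable_under_integral R _ _ mu f D mD w (w - 1) (w + 1) wI
  (fun t _ => fi t) df1 g g0 gi ub.
have d2 := @differentiation_under_integral R _ _ mu f D mD w (w - 1) (w + 1) wI
  (fun t _ => fi t) df1 g g0 gi ub.
have := derivableP d1; rewrite -derive1E d2 => /der_eq; apply.
by apply: eq_Rintegral => x _; rewrite dE.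
Qed.

Lemma der_ftre h k m N w : sqint h k N -> continuous m ->
  is_derive w 1 (ftre m h k) (ftim m (fun x => m x * h x) (fun x => m x * k x) w).
Proof.
move=> hk cm; have [N' mhk] := sqint_mul hk cm.
have [mhi mki] := sqint_integrable mhk.
pose g x := `|m x * h x| + `|m x * k x|.
apply: (@der_integral (fun w x => rotre (h x) (k x) (m x * w))
  (fun w x => rotim (m x * h x) (m x * k x) (m x * w)) g) => //.
- move=> x t; apply: (der_eq (der_rotre (h x) (k x) (m x) t)).
  by rewrite rotimZ.
- by move=> t; have [] := has_integral_ftre t hk cm.
- have h1 := integrable_norm mhi.
  have h2 := integrable_norm mki.
  by have := @integrableD _ _ _ mu D mD _ _ h1 h2; apply: eq_integrable.
- by move=> x; rewrite addr_ge0.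
- move=> t x _; rewrite rotimE (le_trans (rot_norm_le _ _ _))//.
  by rewrite normrN addrC.
Qed.

Lemma der_ftim h k m N w : sqint h k N -> continuous m ->
  is_derive w 1 (ftim m h k) (- ftre m (fun x => m x * h x) (fun x => m x * k x) w).
Proof.
move=> hk cm; have := der_ftre w (sqint_swap hk) cm.
have -> : ftim m h k = ftre m k (fun x => - h x) by apply/funext => t; exact: ftimE.
move=> /der_eq; apply; rewrite ftimE.
rewrite /ftre -[RHS]mulN1r -RintegralZl//.
  by apply: eq_Rintegral => x _; rewrite /rotre; ring.
have [N' mhk] := sqint_mul hk cm.
by have [] := has_integral_ftre w mhk cm.
Qed.

(* [centred_angle x * w = 2 pi w (x - 1/2)]: centring makes the frequencies of
   the transform symmetric, hence at most pi. *)
Definition centred_angle (x : R) := 2 * pi * x - pi.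

Lemma continuous_centred_angle : continuous centred_angle.
Proof.
move=> x; apply: (@der_continuous _ _ _ (2 * pi)).
by rewrite /centred_angle; dereq; ring.
Qed.

Lemma centred_angle_sqr_le x : D x -> centred_angle x ^+ 2 <= pi ^+ 2.
Proof.
rewrite /= in_itv /= /centred_angle => /andP[x0 x1]; have p0 := pi_gt0 R.
have : 0 <= pi ^+ 2 * (x * (1 - x)) by rewrite mulr_ge0 ?sqr_ge0// mulr_ge0// subr_ge0.
nra.
Qed.

(** Orthonormality of the exponentials: from x = 0 to x = 1 the phase changes by a multiple of 2 pi,
    so for distinct indices the antiderivative returns to its initial value. *)
Let trig_integral (i j : nat) :
  has_integral D (fun x => cos (centred_angle x * (j%:R - i%:R))) (i == j)%:R /\
  has_integral D (fun x => sin (centred_angle x * (j%:R - i%:R))) 0.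
Proof.
have [->|ij] := eqVneq i j.
  rewrite subrr; split.
    have := @has_integral_itv R (fun x => x) (fun=> 1) 0 1 ltr01.
    rewrite subr0 => H; apply: (has_integral_ext _ _ (H _ _)) => //.
    - by move=> x _; rewrite mulr0 cos0.
    - by move=> x; exact: cst_continuous.
  by apply: (has_integral_ext _ _ (has_integral0 mD)) => // x _; rewrite mulr0 sin0.
have p0 := pi_gt0 R; have dN0 : (j%:R - i%:R : R) != 0.
  by rewrite subr_eq0 eqr_nat eq_sym.
set d : R := j%:R - i%:R in dN0 *.
have e1 : centred_angle 1 * d = centred_angle 0 * d + (j%:R - i%:R) * (2 * pi).
  by rewrite /centred_angle -/d; ring.
have s1 : sin (centred_angle 1 * d) = sin (centred_angle 0 * d).
  by rewrite e1 sinD2pin.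
have c1 : cos (centred_angle 1 * d) = cos (centred_angle 0 * d).
  by rewrite e1 cosD2pin.
have cc := continuous_centred_angle.
have m0 : 2 * pi * d != 0 by rewrite !mulf_neq0// gt_eqF.
split.
- have := @has_integral_itv R (fun x => (2 * pi * d)^-1 * sin (centred_angle x * d))
    (fun x => cos (centred_angle x * d)) 0 1 ltr01 (@cos_cont _ _ cc).
  rewrite s1 subrr; apply => x; rewrite /centred_angle; dereq.
  by move: (cos _) (sin _) dN0 => C S dN0; gen_pi; field; rewrite dN0 pN1.
- have := @has_integral_itv R (fun x => - (2 * pi * d)^-1 * cos (centred_angle x * d))
    (fun x => sin (centred_angle x * d)) 0 1 ltr01 (@sin_cont _ _ cc).
  rewrite c1 subrr; apply => x; rewrite /centred_angle; dereq.
  by move: (cos _) (sin _) dN0 => C S dN0; gen_pi; field; rewrite dN0 pN1.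
Qed.

(* |f - sum_j F_j e_j|^2 >= 0 integrates to the inequality, for the orthonormal
   family e_j = exp (i (b + j) centred_angle) on [0, 1]. *)
Lemma bessel h k N (b : R) (L : nat) : sqint h k N ->
  \sum_(j < L) (ftre centred_angle h k (b + j%:R) ^+ 2 +
                ftim centred_angle h k (b + j%:R) ^+ 2) <= N.
Proof.
move=> hk; set m := centred_angle; have cm := continuous_centred_angle.
pose A j := ftre m h k (b + j%:R); pose B j := ftim m h k (b + j%:R).
pose y (j : nat) x := m x * (b + j%:R).
(* P + i Q is the projection sum_j F_j e_j. Its real inner product with f and its squared norm are
   both sum_j |F_j|^2. *)
pose P x := \sum_(j < L) rotre (A j) (B j) (- y j x).
pose Q x := \sum_(j < L) rotim (A j) (B j) (- y j x).
have hPQ : has_integral D (fun x => h x * P x + k x * Q x)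
    (\sum_(j < L) (A j ^+ 2 + B j ^+ 2)).
  apply: (@has_integral_ext R D (fun x => \sum_(j < L)
    (A j * rotre (h x) (k x) (y j x) + B j * rotim (h x) (k x) (y j x)))) => //.
    move=> x _; rewrite /P /Q !mulr_sumr -big_split; apply: eq_bigr => j _.
    by rewrite /= rot_adjoint.
  apply: has_integral_sum => // j; rewrite !expr2.
  apply: has_integralD => //; apply: has_integralZ => //.
    exact: has_integral_ftre hk cm.
  exact: has_integral_ftim hk cm.
have PQ : has_integral D (fun x => P x ^+ 2 + Q x ^+ 2)
    (\sum_(j < L) (A j ^+ 2 + B j ^+ 2)).
  apply: (@has_integral_ext R D (fun x => \sum_(i < L) \sum_(j < L)
    ((A i * A j + B i * B j) * cos (m x * (j%:R - i%:R)) +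
     (B i * A j - A i * B j) * sin (m x * (j%:R - i%:R))))) => //.
    move=> x _; rewrite /P /Q !expr2 !big_distrlr /= -big_split.
    apply: eq_bigr => i _; rewrite -big_split; apply: eq_bigr => j _ /=.
    by rewrite rot_inner /y; congr (_ * cos _ + _ * sin _); ring.
  have -> : \sum_(j < L) (A j ^+ 2 + B j ^+ 2) = \sum_(i < L) \sum_(j < L)
      ((A i * A j + B i * B j) * (i == j :> nat)%:R + (B i * A j - A i * B j) * 0).
    apply: eq_bigr => i _; rewrite (bigD1 i)//= eqxx big1 ?addr0; last first.
      move=> j ji; rewrite (_ : (i == j :> nat) = false) ?mulr0 ?addr0//.
      by apply/negbTE; rewrite eq_sym.
    by rewrite mulr1 mulr0; ring.
  apply: has_integral_sum => // i; apply: has_integral_sum => // j.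
  have [h1 h2] := trig_integral i j.
  by apply: has_integralD => //; apply: has_integralZ.
have [_ _ hkN] := hk.
set S := \sum_(j < L) (A j ^+ 2 + B j ^+ 2) in hPQ PQ.
have tot : has_integral D (fun x => (h x ^+ 2 + k x ^+ 2) +
    ((- 2) * (h x * P x + k x * Q x) + (P x ^+ 2 + Q x ^+ 2))) (N + (- 2 * S + S)).
  by apply: has_integralD => //; apply: has_integralD => //; exact: has_integralZ.
have := has_integral_le mD (has_integral0 mD) tot => H.
suff : 0 <= N + (- 2 * S + S) by rewrite -/S; lra.
apply: H => x _; have := sqr_ge0 (h x - P x); have := sqr_ge0 (k x - Q x).
nra.
Qed.

(** F' is the transform of f multiplied by -i [centred_angle], and this factor has modulus at most
    pi on [0, 1]. *)
Lemma bessel_deriv h k N (b : R) (L : nat) : sqint h k N ->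
  \sum_(j < L)
    (ftre centred_angle (fun x => centred_angle x * h x)
       (fun x => centred_angle x * k x) (b + j%:R) ^+ 2 +
     ftim centred_angle (fun x => centred_angle x * h x)
       (fun x => centred_angle x * k x) (b + j%:R) ^+ 2) <= pi ^+ 2 * N.
Proof.
move=> hk; have cm := continuous_centred_angle.
have [N' hk'] := sqint_mul hk cm; apply: (le_trans (bessel b L hk')).
have [_ _ N'E] := hk'; have [_ _ NE] := hk.
apply: (has_integral_le mD N'E (has_integralZ (pi ^+ 2) mD NE)) => x Dx.
rewrite !exprMn -mulrDr ler_wpM2r ?addr_ge0 ?sqr_ge0//.
exact: centred_angle_sqr_le.
Qed.

End Transform.

(** * The upper sampling bound *)

Section UpperBound.
Context {R : realType}.
Local Notation mu := (@lebesgue_measure R).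
Implicit Types (x y t c : R).

(** [riccati_growth] for -H, -V and -a. *)
Lemma riccati_upper (H u v du dv V dV : R -> R) (a b x y : R) :
  x <= y -> 0 < b ->
  (forall t, x <= t <= y -> is_derive t 1 u (du t)) ->
  (forall t, x <= t <= y -> is_derive t 1 v (dv t)) ->
  (forall t, x <= t <= y -> is_derive t 1 V (dV t)) ->
  (forall t, x <= t <= y -> is_derive t 1 H
     (a * (u t ^+ 2 + v t ^+ 2) + b * (du t ^+ 2 + dv t ^+ 2))) ->
  (forall t, x <= t <= y -> dV t + V t ^+ 2 / b <= a) ->
  V y * (u y ^+ 2 + v y ^+ 2) - V x * (u x ^+ 2 + v x ^+ 2) <= H y - H x.
Proof.
move=> xy b0 uE vE VE HE dVle.
have NE t : x <= t <= y -> is_derive t 1 (fun s => - H s)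
    (- a * (u t ^+ 2 + v t ^+ 2) - b * (du t ^+ 2 + dv t ^+ 2)).
  by move=> /HE dH; apply: (der_eq (derN dH)); ring.
have NV t : x <= t <= y -> is_derive t 1 (fun s => - V s) (- dV t).
  by move=> /VE; exact: derN.
have := riccati_growth xy b0 uE vE NV NE.
suff Vle t : x <= t <= y -> - a + (- V t) ^+ 2 / b <= - dV t by move=> /(_ Vle); lra.
by move=> /dVle; rewrite sqrrN; lra.
Qed.

Section RationalProfile.
Variable delta : R.
Hypothesis d01 : 0 < delta < 1.
Let d0 : 0 < delta. Proof. by case/andP: d01. Qed.

(** With a = 1 + delta and b = (1 + delta) delta / pi^2, the equation V' + V^2 / b = a is solved by
    a hyperbolic tangent. [upper_arm] is a rational function that agrees with it to third order at
    0; this fixes [kappa] and leaves a defect proportional to (kappa t^2)^2. *)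
Let kappa : R := pi ^+ 2 / (3 * delta).
Definition upper_arm t := (1 + delta) * t / (1 + kappa * t ^+ 2).
Definition dupper_arm t := (1 + delta) * (1 - kappa * t ^+ 2) / (1 + kappa * t ^+ 2) ^+ 2.

Let p20 : 0 < (pi : R) ^+ 2. Proof. by rewrite exprn_gt0// pi_gt0. Qed.

Let kappa0 : 0 < kappa. Proof. by rewrite divr_gt0// mulr_gt0. Qed.

Let den0 t : 0 < 1 + kappa * t ^+ 2.
Proof. by rewrite ltr_pwDl// mulr_ge0 ?sqr_ge0 ?(ltW kappa0). Qed.

Lemma upper_armN t : upper_arm (- t) = - upper_arm t.
Proof. by rewrite /upper_arm sqrrN mulrN mulNr. Qed.

Lemma der_upper_arm t : is_derive t 1 upper_arm (dupper_arm t).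
Proof.
rewrite /upper_arm; notypeclasses refine (der_eq _ _).
  notypeclasses refine (derM _ _); [der|].
  by notypeclasses refine (derV _ _); [rewrite gt_eqF|der].
have := den0 t; rewrite /dupper_arm; move: kappa => c.
by move=> /lt0r_neq0 ?; field.
Qed.

Lemma upper_arm_riccati t : dupper_arm t +
  upper_arm t ^+ 2 / ((1 + delta) * delta / pi ^+ 2) <= 1 + delta.
Proof.
have dN := lt0r_neq0 (den0 t); have dd0 := lt0r_neq0 d0; have h := d0.
have d10 : 1 + delta != 0 by rewrite gt_eqF//; lra.
have pE : pi ^+ 2 = kappa * (3 * delta).
  by rewrite /kappa mulfVK// mulf_neq0.
rewrite -subr_ge0 /upper_arm /dupper_arm pE; move: kappa0 (den0 t) dN.
move: kappa => c c0 dp dN.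
have -> : 1 + delta - ((1 + delta) * (1 - c * t ^+ 2) / (1 + c * t ^+ 2) ^+ 2 +
   ((1 + delta) * t / (1 + c * t ^+ 2)) ^+ 2 / ((1 + delta) * delta / (c * (3 * delta)))) =
   (1 + delta) * (c * t ^+ 2) ^+ 2 / (1 + c * t ^+ 2) ^+ 2.
  by field; rewrite dN dd0 d10 gt_eqF.
by rewrite divr_ge0 ?sqr_ge0// mulr_ge0 ?sqr_ge0//; lra.
Qed.

(* This is where pi^2 <= 12 is needed. *)
Lemma upper_arm_ge t : 0 <= t <= delta / 2 -> t <= upper_arm t.
Proof.
move=> /andP[t0 td]; rewrite /upper_arm ler_pdivlMr// mulrC.
rewrite ler_wpM2r// lerD2l.
have h := d0; have t2 : t ^+ 2 <= (delta / 2) ^+ 2.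
  by rewrite ler_pXn2r ?nnegrE// divr_ge0// ltW.
apply: (@le_trans _ _ (kappa * (delta / 2) ^+ 2)).
  by rewrite ler_wpM2l// ltW.
have -> : kappa * (delta / 2) ^+ 2 = pi ^+ 2 / 12 * delta.
  by rewrite /kappa; gen_pi; field; rewrite gt_eqF.
have := @pi_sqr_le12 R; have := p20; nra.
Qed.

End RationalProfile.

Section Sampling.
Variables (h k : R -> R) (N delta : R) (w : nat -> R) (n : nat).
Hypothesis hk : sqint h k N.
Hypothesis d01 : 0 < delta < 1.
Hypothesis wS : forall i, (i <= n)%N -> w i <= w i.+1.
Hypothesis wd : forall i, (i <= n)%N -> w i.+1 - w i <= delta.

Local Notation m := (@centred_angle R).
Local Notation z := (midpoint w).
Let cm := @continuous_centred_angle R.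
Let u := ftre m h k.
Let v := ftim m h k.
Let h' x := m x * h x.
Let k' x := m x * k x.
Let du := ftim m h' k'.
Let dv t := - ftre m h' k' t.
Let G t := u t ^+ 2 + v t ^+ 2.
Let dG t := du t ^+ 2 + dv t ^+ 2.
Let a := 1 + delta.
Let b := (1 + delta) * delta / pi ^+ 2.

Let uE (t : R) : is_derive t 1 u (du t). Proof. exact: der_ftre hk cm. Qed.
Let vE (t : R) : is_derive t 1 v (dv t). Proof. exact: der_ftim hk cm. Qed.

Let du_cont : continuous du.
Proof.
by have [N' hk'] := sqint_mul hk cm => t; apply: der_continuous (der_ftim t hk' cm).
Qed.

Let dv_cont : continuous dv.
Proof.
have [N' hk'] := sqint_mul hk cm => t.
exact: der_continuous (derN (der_ftre t hk' cm)).
Qed.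

Let dens t := a * G t + b * dG t.

Let dens_cont : continuous dens.
Proof.
have sq (f : R -> R) : continuous f -> continuous (fun t => f t ^+ 2).
  move=> cf t; rewrite (_ : (fun t => f t ^+ 2) = (fun t => f t * f t)).
    by apply: continuousM; exact: cf.
  by apply/funext => s; rewrite expr2.
have cu : continuous u by move=> t; exact: der_continuous (uE t).
have cv : continuous v by move=> t; exact: der_continuous (vE t).
have cD (f g : R -> R) : continuous f -> continuous g -> continuous (fun t => f t + g t).
  by move=> cf cg t; apply: continuousD; [exact: cf|exact: cg].
have cZ (c : R) (f : R -> R) : continuous f -> continuous (fun t => c * f t).
  by move=> cf t; apply: continuousM; [exact: cst_continuous|exact: cf].
exact: (cD _ _ (cZ _ _ (cD _ _ (sq _ cu) (sq _ cv)))
  (cZ _ _ (cD _ _ (sq _ du_cont) (sq _ dv_cont)))).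
Qed.

(** The base point lies to the left of [z 0], so that [H] has a two-sided derivative at [z 0]
    too. *)
Let H t := Rintegral mu [set` `[z 0%N - 1, t]] dens.

Let HE t : z 0%N - 1 < t -> is_derive t 1 H (dens t).
Proof.
move=> t0; have tt1 : t < t + 1 by rewrite ltrDl.
have di : mu.-integrable `[z 0%N - 1, t + 1] (EFin \o dens).
  apply: continuous_compact_integrable; first exact: segment_compact.
  exact: continuous_subspaceT.
have [d1 d2] := continuous_FTC1_closed tt1 di t0 (@dens_cont t).
by have := derivableP d1; rewrite -derive1E d2.
Qed.

Let d0 : 0 < delta. Proof. by case/andP: d01. Qed.
Let b0 : 0 < b.
Proof. by rewrite divr_gt0 ?exprn_gt0 ?pi_gt0// mulr_gt0// addr_gt0. Qed.
Let G0 t : 0 <= G t. Proof. by rewrite addr_ge0 ?sqr_ge0. Qed.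
Let dens0 t : 0 <= dens t.
Proof.
have h1 := d0; have h2 := b0.
by rewrite addr_ge0// mulr_ge0// ?addr_ge0 ?sqr_ge0// ltW// /a; lra.
Qed.

Let r := upper_arm delta.

Let arm c x y : x <= y -> z 0%N - 1 < x ->
  r (y - c) * G y - r (x - c) * G x <= H y - H x.
Proof.
move=> xy x0; apply: (@riccati_upper H u v du dv (fun s => r (s - c))
  (fun s => dupper_arm delta (s - c)) a b x y xy b0
  (fun t _ => uE t) (fun t _ => vE t)) => [t _|t /andP[xt _]|t _].
- notypeclasses refine (der_eq _ _).
    by notypeclasses refine (der_comp (g := fun s => s - c) (der_upper_arm d01 _) _); der.
  by rewrite addr0 mul1r.
- by apply: HE; exact: lt_le_trans xt.
- exact: upper_arm_riccati.
Qed.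

Let r0 : r 0 = 0. Proof. by rewrite /r /upper_arm mulr0 mul0r. Qed.

Let rarm c y : z 0%N <= c -> c <= y -> y - c <= delta / 2 -> (y - c) * G y <= H y - H c.
Proof.
move=> zc cy yc; have := @arm c c y cy ltac:(lra).
rewrite subrr r0 mul0r subr0; apply: le_trans; rewrite ler_wpM2r//.
by apply: upper_arm_ge => //; apply/andP; split; lra.
Qed.

Let larm x c : z 0%N <= x -> x <= c -> c - x <= delta / 2 -> (c - x) * G x <= H c - H x.
Proof.
move=> zx xc cx; have := @arm c x c xc ltac:(lra).
rewrite subrr r0 mul0r sub0r -[x - c]opprB /r upper_armN mulNr opprK; apply: le_trans.
rewrite ler_wpM2r//; apply: upper_arm_ge => //; apply/andP; split; lra.
Qed.

Let zw i : (i <= n)%N ->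
  [/\ w i <= z i, z i <= w i.+1, z i - w i <= delta / 2 & w i.+1 - z i <= delta / 2].
Proof. by move=> ni; have := wS ni; have := wd ni; rewrite /midpoint; split; lra. Qed.

Let zmono i : (i <= n)%N -> z 0%N <= z i.
Proof.
elim: i => // i IHi ni; apply: le_trans (IHi (ltnW ni)) _.
have [_ h1 _ _] := @zw i (ltnW ni); have [h2 _ _ _] := @zw i.+1 ni.
exact: le_trans h1 h2.
Qed.

Let cells j : (j <= n)%N ->
  \sum_(0 <= i < j) (z i.+1 - z i) * G (w i.+1) <= H (z j) - H (z 0%N).
Proof.
elim: j => [|j IHj] jn; first by rewrite big_geq// subrr.
rewrite big_nat_recr//=.
have [_ h1 _ h2] := @zw j (ltnW jn); have [h3 _ h4 _] := @zw j.+1 jn.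
have z0 := zmono (ltnW jn); have := IHj (ltnW jn).
have := rarm z0 h1 h2; have := larm (le_trans z0 h1) h3 h4; lra.
Qed.

Let Hmono x y : z 0%N <= x -> x <= y -> H x <= H y.
Proof.
move=> zx xy; apply: (@der_ge0_le _ H dens x y xy) => // t /andP[xt _].
by apply: HE; lra.
Qed.

(* Averaging over the unit translates of the grid z 0 + Z turns the integral of
   the density over a long interval into Bessel sums. *)
Let total (L : nat) : H (z 0%N + L%:R) - H (z 0%N) <= (1 + delta) ^+ 2 * N.
Proof.
have dP (t : R) : 0 <= t <= 1 ->
    is_derive t 1 (fun s => \sum_(j < L) H (z 0%N + j%:R + s))
      (\sum_(j < L) dens (z 0%N + t + j%:R)).
  move=> /andP[t0 t1].
  apply: (@der_sum R 'I_L _ (fun j s => H (z 0%N + j%:R + s))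
    (fun j t => dens (z 0%N + t + j%:R)) t) => j.
  have j0 : (0 : R) <= j%:R by rewrite ler0n.
  notypeclasses refine (der_eq _ _).
    notypeclasses refine (der_comp (g := fun s => z 0%N + j%:R + s) (HE _) _).
      lra.
    by der.
  by rewrite add0r mul1r addrAC.
(* The mean value theorem does the averaging: some translate [t] attains the mean, and the sum of
   the increments telescopes. *)
have [t /andP[t0 t1]] := der_mvt ler01 dP.
have tele : \sum_(j < L) H (z 0%N + j%:R + 1) - \sum_(j < L) H (z 0%N + j%:R + 0) =
    H (z 0%N + L%:R) - H (z 0%N).
  elim: L {dP t0 t1} => [|L IHL]; first by rewrite !big_ord0 addr0 !subrr.
  rewrite !big_ord_recr /= -natr1 addrA [z 0%N + L%:R + 0]addr0; lra.
rewrite tele subr0 mulr1 => ->.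
have b1 := bessel (z 0%N + t) L hk; have b2 := bessel_deriv (z 0%N + t) L hk.
have -> : \sum_(j < L) dens (z 0%N + t + j%:R) =
    a * (\sum_(j < L) (u (z 0%N + t + j%:R) ^+ 2 + v (z 0%N + t + j%:R) ^+ 2)) +
    b * (\sum_(j < L) (ftre m h' k' (z 0%N + t + j%:R) ^+ 2 +
       ftim m h' k' (z 0%N + t + j%:R) ^+ 2)).
  rewrite !mulr_sumr -big_split; apply: eq_bigr => j _.
  by rewrite /dens /G /dG /dv sqrrN [_ + ftre _ _ _ _ ^+ 2]addrC.
have h1 := d0; have a0 : 0 < a by rewrite /a; lra.
(* The two Bessel bounds combine through a + b pi^2 = (1 + delta)^2. *)
have -> : (1 + delta) ^+ 2 * N = a * N + b * (pi ^+ 2 * N).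
  by rewrite /a /b; gen_pi; field.
by rewrite lerD// ler_pM2l.
Qed.

Lemma ft_sampling_upper :
  \sum_(0 <= i < n) (z i.+1 - z i) *
    (ftre m h k (w i.+1) ^+ 2 + ftim m h k (w i.+1) ^+ 2) <= (1 + delta) ^+ 2 * N.
Proof.
apply: (le_trans (cells (leqnn n))).
pose L := Num.truncn (z n - z 0%N).
have zL : z n <= z 0%N + L.+1%:R.
  by have := truncnS_gt (z n - z 0%N); rewrite -/L; lra.
apply: le_trans (total L.+1); rewrite lerD2r.
exact: Hmono (zmono (leqnn n)) zL.
Qed.

End Sampling.

End UpperBound.

(** * The Rayleigh quotient as a weighted sum of samples *)

Section RayleighQuotient.
Context {R : realType}.
Local Notation mu := (@lebesgue_measure R).
Local Notation D := (`[0, 1]%classic : set (measurableTypeR R)).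
Implicit Types (f : R -> R[i]) (K delta : R) (N : nat) (w : nat -> R).

Let mD : measurable D. Proof. exact: measurable_itv. Qed.

Lemma creM (x y : R[i]) : cre (x * y) = cre x * cre y - cim x * cim y.
Proof. by case: x y => [a b] [c d]. Qed.

Lemma cimM (x y : R[i]) : cim (x * y) = cre x * cim y + cim x * cre y.
Proof. by case: x y => [a b] [c d] /=; rewrite /cim /cre /= addrC; ring. Qed.

Lemma cre_sum (I : Type) (r : seq I) (F : I -> R[i]) :
  cre (\sum_(i <- r) F i) = \sum_(i <- r) cre (F i).
Proof.
elim: r => [|i r IHr]; first by rewrite !big_nil.
by rewrite !big_cons -IHr; case: (F i) (\sum_(j <- r) F j) => [a b] [c d].
Qed.

Lemma cim_sum (I : Type) (r : seq I) (F : I -> R[i]) :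
  cim (\sum_(i <- r) F i) = \sum_(i <- r) cim (F i).
Proof.
elim: r => [|i r IHr]; first by rewrite !big_nil.
by rewrite !big_cons -IHr; case: (F i) (\sum_(j <- r) F j) => [a b] [c d].
Qed.

Lemma cre_conj (x : R[i]) : cre (conjc x) = cre x. Proof. by case: x. Qed.
Lemma cim_conj (x : R[i]) : cim (conjc x) = - cim x. Proof. by case: x. Qed.

Lemma notin01 (x : R) : ~ D x -> x < 0 \/ 1 < x.
Proof.
rewrite /= in_itv /= => /negP; rewrite negb_and -!ltNge => /orP[]; by [left|right].
Qed.

Lemma Hspace_sqint f : Hspace f ->
  sqint (fun x => cre (f x)) (fun x => cim (f x)) (norm2 f).
Proof.
move=> [[m1 [m2 ff]] f0]; split; [exact: measurable_funTS|exact: measurable_funTS|].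
have fD : mu.-integrable D (EFin \o (fun x => cre (f x) ^+ 2 + cim (f x) ^+ 2)).
  exact: integrableS ff.
split => //; apply/esym; apply: (@has_integral_setT _ D) => //.
by move=> x /notin01/f0 ->; rewrite /cabs2 /= expr0n addr0.
Qed.

Let angle (x : R) := 2 * pi * x.

Let angle_cont : continuous angle.
Proof.
by move=> x; apply: (@der_continuous _ _ _ (2 * pi)); rewrite /angle; dereq; ring.
Qed.

Let fourier_re f (w : R) : Hspace f ->
  cre (fourier f w) = ftre angle (fun x => cre (f x)) (fun x => cim (f x)) w.
Proof.
move=> Hf; have hk := Hspace_sqint Hf.
apply: (@has_integral_setT _ D) => //.
  by move=> x /notin01; have [_ /[apply] ->] := Hf; rewrite mul0r.
apply: has_integral_ext (has_integral_ftre w hk angle_cont) => // x _.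
rewrite creM /expi /cre /cim /= cosN sinN /rotre /angle.
by rewrite (_ : 2 * pi * x * w = 2 * pi * w * x); ring.
Qed.

Let fourier_im f (w : R) : Hspace f ->
  cim (fourier f w) = ftim angle (fun x => cre (f x)) (fun x => cim (f x)) w.
Proof.
move=> Hf; have hk := Hspace_sqint Hf.
apply: (@has_integral_setT _ D) => //.
  by move=> x /notin01; have [_ /[apply] ->] := Hf; rewrite mul0r.
apply: has_integral_ext (has_integral_ftim w hk angle_cont) => // x _.
rewrite cimM /expi /cre /cim /= cosN sinN /rotim /angle.
by rewrite (_ : 2 * pi * x * w = 2 * pi * w * x); ring.
Qed.

(** Centring the phase multiplies the transform by e^(i pi w), of modulus 1. *)
Lemma fourier_norm f (w : R) : Hspace f -> cabs2 (fourier f w) =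
  ftre (@centred_angle R) (fun x => cre (f x)) (fun x => cim (f x)) w ^+ 2 +
  ftim (@centred_angle R) (fun x => cre (f x)) (fun x => cim (f x)) w ^+ 2.
Proof.
move=> Hf; have hk := Hspace_sqint Hf; rewrite /cabs2 fourier_re// fourier_im//.
set h := fun x => _; set k := fun x => cim _.
have [_ hre] := has_integral_ftre w hk angle_cont.
have cE x : centred_angle x * w = angle x * w - pi * w.
  by rewrite /centred_angle /angle; ring.
set A := ftre angle h k w; set B := ftim angle h k w.
have -> : ftre (@centred_angle R) h k w = cos (pi * w) * A - sin (pi * w) * B.
  have Hd := has_integralD mD (has_integralZ (cos (pi * w)) mD (has_integral_ftre w hk angle_cont))
    (has_integralZ (- sin (pi * w)) mD (has_integral_ftim w hk angle_cont)).
  rewrite -mulNr -(proj2 Hd); apply: eq_Rintegral => x _.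
  by rewrite /rotre /rotim cE cosB sinB; ring.
have -> : ftim (@centred_angle R) h k w = cos (pi * w) * B + sin (pi * w) * A.
  have Hd := has_integralD mD (has_integralZ (cos (pi * w)) mD (has_integral_ftim w hk angle_cont))
    (has_integralZ (sin (pi * w)) mD (has_integral_ftre w hk angle_cont)).
  rewrite -(proj2 Hd); apply: eq_Rintegral => x _.
  by rewrite /rotre /rotim cE cosB sinB; ring.
have := cos2Dsin2 (pi * w); move: (cos _) (sin _) => c s cs.
have -> : A ^+ 2 + B ^+ 2 = (c ^+ 2 + s ^+ 2) * (A ^+ 2 + B ^+ 2) by rewrite cs mul1r.
ring.
Qed.

Lemma wext_in K N w i : (i < N)%N -> wext K N w i.+1 = w i.+1.
Proof. by move=> iN; rewrite /wext eqSS (ltn_eqF iN). Qed.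

Lemma weightE K N w i : weight K N w i.+1 =
  midpoint (wext K N w) i.+1 - midpoint (wext K N w) i.
Proof. by rewrite /weight /midpoint /=; lra. Qed.

(** Integrated against the conjugate of f, the n-th exponential of [Sop] gives the conjugate of the
    n-th sample. *)
Lemma rayleighE K N w f : Hspace f -> rayleigh K N w f =
  (\sum_(0 <= i < N) (midpoint (wext K N w) i.+1 - midpoint (wext K N w) i) *
    cabs2 (fourier f (wext K N w i.+1))) / norm2 f.
Proof.
move=> Hf; have hk := Hspace_sqint Hf; congr (_ / _).
have -> : \sum_(0 <= i < N) (midpoint (wext K N w) i.+1 - midpoint (wext K N w) i) *
    cabs2 (fourier f (wext K N w i.+1)) =
    \sum_(1 <= n < N.+1) weight K N w n * cabs2 (fourier f (w n)).
  rewrite [RHS]big_add1 /=; apply: eq_big_nat => i /andP[_ iN].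
  by rewrite weightE wext_in.
apply: (@has_integral_setT _ D) => //.
  by move=> x /notin01; have [_ /[apply] ->] := Hf; rewrite conjc0 mulr0.
pose A n := cre (fourier f (w n)); pose B n := cim (fourier f (w n)).
apply: (@has_integral_ext _ D (fun x => \sum_(1 <= n < N.+1) weight K N w n *
  (A n * rotre (cre (f x)) (cim (f x)) (angle x * w n) +
   B n * rotim (cre (f x)) (cim (f x)) (angle x * w n)))) => //.
  move=> x; rewrite /= in_itv /= => x01.
  rewrite creM cre_conj cim_conj mulrN opprK /Sop cre_sum cim_sum !mulr_suml -big_split.
  apply: eq_bigr => n _; rewrite -rot_adjoint !(creM, cimM) -/(A n) -/(B n).
  move: (A n) (B n) => a b; rewrite /ind01 x01 /rotre /rotim /angle cosN sinN.
  by rewrite (_ : 2 * pi * x * w n = 2 * pi * w n * x) /cre /cim /=; ring.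
apply: has_integral_sum => // n; apply: has_integralZ => //.
rewrite /cabs2 !expr2 -/(A n) -/(B n).
apply: has_integralD => //; apply: has_integralZ => //.
  by rewrite /A fourier_re//; exact: has_integral_ftre hk angle_cont.
by rewrite /B fourier_im//; exact: has_integral_ftim hk angle_cont.
Qed.

(** At the two extended ends this holds because w_1 and w_N lie in [-K, K], hence differ by at most
    2K. *)
Lemma dense_wext_le K delta N w : Kdelta_dense K delta N w ->
  forall i, (i <= N)%N -> wext K N w i <= wext K N w i.+1.
Proof.
move=> [K0 [_ [N0 [wS [wK _]]]]] i iN; rewrite /wext.
have [/andP[w1 _] /andP[_ wN]] : (- K <= w 1%N <= K) /\ (- K <= w N <= K).
  by split; apply: wK; lia.
case: i iN => [|i] iN /=; first by rewrite eqSS (ltn_eqF N0); lra.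
rewrite !eqSS (ltn_eqF iN) /=; case: eqVneq => [->|iN']; first lra.
by apply/ltW/wS => //; lia.
Qed.

Lemma rayleigh_upper K delta N w f : Kdelta_dense K delta N w -> Hspace f ->
  0 < norm2 f -> rayleigh K N w f <= (1 + delta) ^+ 2.
Proof.
move=> Kd Hf nf; have [_ [d01 [_ [_ [_ wd]]]]] := Kd.
rewrite rayleighE// ler_pdivrMr//.
apply: le_trans (ft_sampling_upper (Hspace_sqint Hf) d01 (dense_wext_le Kd) wd).
by apply: ler_sum => i _; rewrite fourier_norm.
Qed.

End RayleighQuotient.

(** * Integrals computed cell by cell *)

Section Cells.
Context {R : realType}.
Local Notation mu := (@lebesgue_measure R).
Local Notation Rm := (measurableTypeR R).
Implicit Types (A B : set (measurableTypeR R)) (h g P : R -> R) (a b c I J : R).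

Lemma has_integralU A B h I J : measurable A -> measurable B -> [disjoint A & B] ->
  has_integral A h I -> has_integral B h J -> has_integral (A `|` B) h (I + J).
Proof.
move=> mA mB AB [hA <-] [hB <-].
have mAB : measurable (A `|` B) by exact: measurableU.
have hAB : mu.-integrable (A `|` B) (EFin \o h).
  apply/(integrable_mkcond _ mAB).
  have := @integrableD _ _ _ mu setT measurableT _ _
    (proj1 (integrable_mkcond _ mA) hA) (proj1 (integrable_mkcond _ mB) hB).
  apply: eq_integrable => // x _ /=; rewrite !patchE in_setU.
  have [xA|xA] := boolP (x \in A); have [xB|xB] := boolP (x \in B) => //=.
  - move: AB; rewrite disj_set2E => /eqP/seteqP[/(_ x)]; case.
    by split; exact: set_mem.
  - by rewrite adde0.
  - by rewrite add0e.
  - by rewrite adde0.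
by split => //; rewrite Rintegral_setU.
Qed.

Lemma has_integral_set1 a h : has_integral ([set a] : set Rm) h 0.
Proof.
split; last exact: Rintegral_set1.
apply/integrableP; split; first exact: measurable_fun_set1.
by rewrite integral_set1 ltry.
Qed.

Lemma has_integral_itv_oo P g h a b : a < b -> continuous g ->
  (forall x : R, is_derive x 1 P (g x)) -> (forall x, a < x < b -> h x = g x) ->
  has_integral `]a, b[ h (P b - P a).
Proof.
move=> ab cg dP hg; have [gi gI] := has_integral_itv ab cg dP.
apply: (@has_integral_ext _ _ g).
- by move=> x; rewrite /= in_itv /= => /hg.
- exact: measurable_itv.
have sub : mu.-integrable `]a, b[ (EFin \o g).
  by apply: integrableS gi => //; exact: subset_itv_oo_cc.
split => //; rewrite Rintegral_itv_bndo_bndc// Rintegral_itv_obnd_cbnd//.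
by apply: integrableS gi => //; exact: subset_itv_oc_cc.
Qed.

Lemma has_integral_cell a b c h I J : a <= b -> b < c -> has_integral `[a, b] h I ->
  has_integral `]b, c[ h J -> has_integral `[a, c] h (I + J).
Proof.
move=> ab bc hI hJ; rewrite -[J]addr0.
have -> : `[a, c]%classic = `[a, b] `|` (`]b, c[ `|` [set c]) :> set Rm.
  apply/seteqP; split => x; rewrite /= !in_itv /=.
    move=> /andP[ax xc]; have [xb|bx] := leP x b; first by left; rewrite ax.
    right; move: xc; rewrite le_eqVlt => /predU1P[->|xc]; [by right|by left].
  move=> [/andP[-> xb]|[/andP[bx xc]|->]] /=; first exact: le_trans xb (ltW bc).
    by rewrite (ltW xc) andbT (le_trans ab)// ltW.
  by rewrite lexx andbT (le_trans ab)// ltW.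
apply: has_integralU => //.
- by apply: measurableU => //; exact: measurable_set1.
- rewrite disj_set2E; apply/eqP/seteqP; split => // x [] /=; rewrite !in_itv /=.
  by move=> /andP[_ xb] [/andP[bx _]|xc]; lra.
apply: has_integralU hJ (has_integral_set1 _ _) => //.
rewrite disj_set2E; apply/eqP/seteqP; split => // x [] /=; rewrite in_itv /=.
by move=> /andP[_ xb] xc; lra.
Qed.

(** Nodes are null sets, so [h] is prescribed only inside the cells. *)
Lemma has_integral_cells (L : nat) (g P : nat -> R -> R) h : (0 < L)%N ->
  (forall j, (j < L)%N -> continuous (g j)) ->
  (forall j (x : R), (j < L)%N -> is_derive x 1 (P j) (g j x)) ->
  (forall j x, (j < L)%N -> j%:R / L%:R < x < j.+1%:R / L%:R -> h x = g j x) ->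
  has_integral `[0, 1] h
    (\sum_(j < L) (P j (j.+1%:R / L%:R) - P j (j%:R / L%:R))).
Proof.
move=> L0 cg dP hg; have LR : 0 < (L%:R : R) by rewrite ltr0n.
suff H n : (n <= L)%N -> has_integral `[0, n%:R / L%:R] h
    (\sum_(j < n) (P j (j.+1%:R / L%:R) - P j (j%:R / L%:R))).
  by have := H L (leqnn L); rewrite divff// gt_eqF.
elim: n => [|n IHn] nL.
  by rewrite mul0r big_ord0 set_itv1; exact: has_integral_set1.
rewrite big_ord_recr /=; apply: has_integral_cell (IHn (ltnW nL)) _.
- by rewrite divr_ge0 ?ler0n// ltW.
- by rewrite ltr_pM2r ?invr_gt0// ltr_nat.
apply: (has_integral_itv_oo _ (cg n nL)).
- by rewrite ltr_pM2r ?invr_gt0// ltr_nat.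
- by move=> x; exact: dP.
- by move=> x; exact: hg.
Qed.

End Cells.

(** * Step functions and their transforms *)

Section StepFunctions.
Context {R : realType}.
Local Notation mu := (@lebesgue_measure R).
Local Notation D := (`[0, 1]%classic : set (measurableTypeR R)).
Implicit Types (f : R -> R[i]).

Let mD : measurable D. Proof. exact: measurable_itv. Qed.

(** Cells are open because at a common node the closed indicators of two neighbouring cells add
    up. *)
Definition step_on (L : nat) (p q : nat -> R) f :=
  forall j x, (j < L)%N -> j%:R / L%:R < x < j.+1%:R / L%:R -> f x = Complex (p j) (q j).

Lemma cofR_mul (a : R) (z : R[i]) : z * cofR a = Complex (cre z * a) (cim z * a).
Proof.
case: z => x y; rewrite /cofR /cre /cim /=.
by apply/eqP; rewrite eq_complex /= !mulr0 subr0 add0r !eqxx.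
Qed.

Lemma ind01E (x : R) : ind01 x = ((0 <= x <= 1)%R : bool)%:R.
Proof. by rewrite /ind01; case: ifP. Qed.

(** Each of the [M] cells is divided into [k]; the refinement allows the period L = k M to be
    matched to 2K. *)
Lemma UM_step (M k : nat) f : (0 < M)%N -> (0 < k)%N -> UM M f ->
  exists p q, step_on (k * M) p q f.
Proof.
move=> M0 k0 [c fE].
have MR : 0 < (M%:R : R) by rewrite ltr0n.
have kR : 0 < (k%:R : R) by rewrite ltr0n.
(* Fine cell j lies in coarse cell [j %/ k]; the default 0 is not reached for j < k M. *)
pose e j : R[i] := if insub (j %/ k)%N is Some m then c m * cofR (Num.sqrt M%:R) else 0.
exists (fun j => cre (e j)), (fun j => cim (e j)) => j x jL jx.
have mM : (j %/ k < M)%N by rewrite ltn_divLR// mulnC.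
have -> : Complex (cre (e j)) (cim (e j)) = e j by case: (e j).
have [xl xr] : ((j %/ k)%:R < M%:R * x) /\ (M%:R * x < (j %/ k)%:R + 1).
  have kM : ((k * M)%:R : R) = k%:R * M%:R by rewrite natrM.
  have kM0 : (0 : R) < (k * M)%:R by rewrite kM mulr_gt0.
  move: jx; rewrite ltr_pdivrMr// ltr_pdivlMr// kM => /andP[j1 j2].
  split; rewrite -(ltr_pM2l kR) ?mulrDr ?mulr1.
    apply: (@le_lt_trans _ _ j%:R); last lra.
    by rewrite -natrM ler_nat mulnC leq_divM.
  apply: (@lt_le_trans _ _ j.+1%:R); first lra.
  by rewrite -natrM -natrD ler_nat addnC -mulnS mulnC ltn_ceil.
rewrite fE /e insubT (bigD1 (Ordinal mM))//= big1 ?addr0; last first.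
  move=> m mj; rewrite ind01E (_ : _ && _ = false) ?mulr0.
    by rewrite ?cofR_mul ?mulr0.
  apply/negbTE/negP => /andP[m1 m2]; case/negP: mj; apply/eqP/val_inj => /=.
  have h1 : (m%:R : R) < (j %/ k).+1%:R by rewrite -natr1; lra.
  have h2 : ((j %/ k)%:R : R) < m.+1%:R by rewrite -natr1; lra.
  by move: h1 h2; rewrite !ltr_nat; clear; lia.
rewrite ind01E (_ : _ && _ = true) ?mulr1//.
by apply/andP; split; lra.
Qed.

Lemma UM_supp (M : nat) f x : (0 < M)%N -> UM M f -> (x < 0 \/ 1 < x) -> f x = 0.
Proof.
move=> M0 [c ->] x01; have MR : 0 < (M%:R : R) by rewrite ltr0n.
apply: big1 => m _; rewrite ind01E (_ : _ && _ = false) ?mulr0.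
  by rewrite ?cofR_mul ?mulr0.
apply/negbTE/negP => /andP[m0 m1].
have mM : (m%:R + 1 : R) <= M%:R by rewrite natr1 ler_nat.
have : (0 : R) <= m%:R by rewrite ler0n.
by case: x01 => x01; nra.
Qed.

Lemma step_energy L p q f : (0 < L)%N -> step_on L p q f ->
  has_integral D (fun x => cre (f x) ^+ 2 + cim (f x) ^+ 2)
    (energy (fun j : 'I_L => p j) (fun j : 'I_L => q j) / L%:R).
Proof.
move=> L0 fE; have LR : (L%:R : R) != 0 by rewrite pnatr_eq0 -lt0n.
have := @has_integral_cells R L (fun j _ => p j ^+ 2 + q j ^+ 2)
  (fun j x => (p j ^+ 2 + q j ^+ 2) * x) (fun x => cre (f x) ^+ 2 + cim (f x) ^+ 2) L0.
have -> : energy (fun j : 'I_L => p j) (fun j : 'I_L => q j) / L%:R =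
  \sum_(j < L) ((p j ^+ 2 + q j ^+ 2) * (j.+1%:R / L%:R) -
    (p j ^+ 2 + q j ^+ 2) * (j%:R / L%:R)).
  rewrite mulr_suml; apply: eq_bigr => j _; rewrite -natr1; field.
  by [].
apply.
- by move=> j _ x; exact: cst_continuous.
- by move=> j x _; dereq; ring.
- by move=> j x jL jx; rewrite (fE j x jL jx).
Qed.

Lemma UM_Hspace (M : nat) f : (0 < M)%N -> UM M f -> Hspace f.
Proof.
move=> M0 Uf; have f0 := UM_supp M0 Uf; split; last by move=> x; exact: f0.
have [p [q fE]] := UM_step M0 (ltn0Sn 0) Uf; rewrite mul1n in fE.
have supp (g : R[i] -> R) : g 0 = 0 -> (fun x => g (f x)) = (fun x => g (f x)) \_ D.
  move=> g0; apply/funext => x; rewrite patchE; case: ifPn => // /negP xD.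
  by rewrite f0 ?g0//; apply: notin01 => Dx; apply: xD; exact: mem_set.
have meas (g : R[i] -> R) : g 0 = 0 -> mu.-integrable D (EFin \o (fun x => g (f x))) ->
    measurable_fun setT (fun x => g (f x)).
  move=> g0 /measurable_int/measurable_EFinP mg; rewrite (supp g g0).
  exact/(measurable_restrictT _ mD).
(* Any function of f is constant on each cell, hence integrable; measurability of the two parts is
   read off from this. *)
have intg (g : R[i] -> R) : mu.-integrable D (EFin \o (fun x => g (f x))).
  have [] // := @has_integral_cells R M (fun j _ => g (Complex (p j) (q j)))
    (fun j x => g (Complex (p j) (q j)) * x) (fun x => g (f x)) M0 _ _ _.
  - by move=> j _ x; exact: cst_continuous.
  - by move=> j x _; dereq; ring.
  - by move=> j x jL jx; rewrite (fE j x jL jx).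
split; first by exact: (meas (@cre R) erefl (intg _)).
split; first by exact: (meas (@cim R) erefl (intg _)).
have c0 : cabs2 (0 : R[i]) = 0 by rewrite /cabs2 /= expr0n addr0.
have := proj1 (integrable_mkcond _ mD) (intg (@cabs2 R)).
apply: eq_integrable => // x _; rewrite patchE /=; case: ifPn => // /negP xD.
by rewrite f0 ?c0//; apply: notin01 => Dx; apply: xD; exact: mem_set.
Qed.

(* The factor of a cell of length 1/L, with its limit value at [w = 0], where
   [sinc 0 = 0 / 0 = 0]. *)
Definition cell_factor (L : nat) (w : R) : R :=
  if w == 0 then 1 else sinc (pi * w / L%:R).

Lemma step_ftre L (h k : R -> R) (p q : nat -> R) w : (0 < L)%N ->
  (forall j x, (j < L)%N -> j%:R / L%:R < x < j.+1%:R / L%:R -> h x = p j /\ k x = q j) ->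
  ftre (@centred_angle R) h k w = cell_factor L w / L%:R *
    \sum_(j < L) rotre (p j) (q j) (freq j * w).
Proof.
move=> L0 hE; have LR : (L%:R : R) != 0 by rewrite pnatr_eq0 -lt0n.
have pN0 : (pi : R) != 0 by rewrite gt_eqF// pi_gt0.
have cm := @continuous_centred_angle R.
have cg (a b : R) : continuous (fun x => rotre a b (centred_angle x * w)).
  move=> x; apply: (@der_continuous _ _ _ (2 * pi * w * rotim a b (centred_angle x * w))).
  by rewrite /rotre /centred_angle; dereq; rewrite /rotim; ring.
have hE' j x : (j < L)%N -> j%:R / L%:R < x < j.+1%:R / L%:R ->
    rotre (h x) (k x) (centred_angle x * w) = rotre (p j) (q j) (centred_angle x * w).
  by move=> jL /(hE j x jL)[-> ->].
have [w0|w0] := eqVneq w 0.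
  have dP j (x : R) : (j < L)%N ->
      is_derive x 1 (fun x => p j * x) (rotre (p j) (q j) (centred_angle x * w)).
    by move=> _; dereq; rewrite w0 /rotre !mulr0 cos0 sin0; ring.
  rewrite /ftre (proj2 (has_integral_cells L0 (fun j _ => cg _ _) dP hE')).
  rewrite mulr_sumr; apply: eq_bigr => j _; rewrite /cell_factor w0 eqxx mulr0 /rotre cos0 sin0.
  by rewrite -natr1; field.
have dP j (x : R) : (j < L)%N -> is_derive x 1
    (fun x => - (2 * pi * w)^-1 * rotim (p j) (q j) (centred_angle x * w))
    (rotre (p j) (q j) (centred_angle x * w)).
  move=> _; rewrite /rotim /centred_angle; dereq; rewrite /rotre.
  by move: (cos _) (sin _) => C S; gen_pi; field; rewrite w0 pN1.
rewrite /ftre (proj2 (has_integral_cells L0 (fun j _ => cg _ _) dP hE')).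
rewrite mulr_sumr; apply: eq_bigr => j _; rewrite /cell_factor (negbTE w0) /sinc.
set s := pi * w / L%:R.
have sN0 : s != 0 by rewrite !mulf_neq0// invr_eq0.
(* [freq j * w] is the phase at the middle of the cell and [s] half its variation; the difference of
   the antiderivative at the ends produces the factor sin s. *)
have -> : centred_angle (j.+1%:R / L%:R) * w = freq j * w + s.
  by rewrite /s /centred_angle /freq -natr1; gen_pi; field.
have -> : centred_angle (j%:R / L%:R) * w = freq j * w - s.
  by rewrite /s /centred_angle /freq; gen_pi; field.
have sE : (2 * pi * w)^-1 = (2 * s * L%:R)^-1.
  by congr _^-1; rewrite /s; gen_pi; field.
rewrite sE /rotim /rotre !cosD !sinD cosN sinN.
by move: (cos _) (sin _) (cos _) (sin _) => C S C' S'; field; rewrite ?sN0 ?LR.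
Qed.

Lemma step_fourier L p q f w : (0 < L)%N -> Hspace f -> step_on L p q f ->
  cabs2 (fourier f w) = (cell_factor L w / L%:R) ^+ 2 *
    (trigre (fun j : 'I_L => p j) (fun j : 'I_L => q j) w ^+ 2 +
     trigim (fun j : 'I_L => p j) (fun j : 'I_L => q j) w ^+ 2).
Proof.
move=> L0 Hf fE; rewrite fourier_norm// ftimE.
rewrite (@step_ftre L _ _ p q)//; last by move=> j x jL jx; rewrite (fE j x jL jx).
rewrite (@step_ftre L _ _ q (fun j => - p j))//; last first.
  by move=> j x jL jx; rewrite (fE j x jL jx).
rewrite !exprMn -mulrDr; congr (_ * (_ + _ ^+ 2)).
by apply: eq_bigr => j _; rewrite rotimE.
Qed.

Lemma cell_factor_ge L (w y : R) : (0 < L)%N -> 0 < y <= pi -> `|pi * w / L%:R| <= y ->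
  sinc y <= cell_factor L w.
Proof.
move=> L0 /andP[y0 ypi] wy; rewrite /cell_factor; case: eqVneq => [_|w0].
  by rewrite /sinc ler_pdivrMr// mul1r sin_le_id// ltW.
apply: sinc_ge => //; rewrite !mulf_neq0 ?invr_eq0 ?pnatr_eq0 -?lt0n//.
by rewrite gt_eqF// pi_gt0.
Qed.

Lemma step_sampling_lower L p q f K delta N w (m n : nat) (y : R) :
  (0 < L)%N -> Hspace f -> step_on L p q f -> Kdelta_dense K delta N w ->
  (m <= n <= N)%N -> midpoint (wext K N w) m + L%:R <= midpoint (wext K N w) n ->
  0 < y <= pi ->
  (forall i, (m <= i < n)%N -> `|pi * wext K N w i.+1 / L%:R| <= y) ->
  sinc y ^+ 2 * (1 - delta) ^+ 2 * norm2 f <=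
  \sum_(m <= i < n) (midpoint (wext K N w) i.+1 - midpoint (wext K N w) i) *
    cabs2 (fourier f (wext K N w i.+1)).
Proof.
move=> L0 Hf fE Kd /andP[mn nN] zmn y01 wy.
have LR : (0 : R) < L%:R by rewrite ltr0n.
have [_ [d01 [_ [_ [_ wd]]]]] := Kd; have wS := dense_wext_le Kd.
have [_ _ [_ nf]] := Hspace_sqint Hf.
have [_] := step_energy L0 fE; rewrite nf => ->.
set E := energy _ _.
have := @trig_sampling_lower R L (fun j : 'I_L => p j) (fun j : 'I_L => q j) L0 delta
  (wext K N w) m n d01 mn _ _ zmn.
move=> H.
have {}H : L%:R * (1 - delta) ^+ 2 * E <=
    \sum_(m <= i < n) (midpoint (wext K N w) i.+1 - midpoint (wext K N w) i) *
      (trigre (fun j : 'I_L => p j) (fun j : 'I_L => q j) (wext K N w i.+1) ^+ 2 +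
       trigim (fun j : 'I_L => p j) (fun j : 'I_L => q j) (wext K N w i.+1) ^+ 2).
  by apply: H => i /andP[_ im]; [apply: wS|apply: wd]; nlia.
have y0 : 0 < y by case/andP: y01.
have s0 : 0 <= sinc y by rewrite divr_ge0 ?(ltW y0)// sin_ge0_pi//; case/andP: y01 => /ltW-> ->.
(* The squared norm of f is E / L, so one factor L cancels; at the samples in use the cell factor is
   at least sinc y. *)
apply: (@le_trans _ _ ((sinc y / L%:R) ^+ 2 * (L%:R * (1 - delta) ^+ 2 * E))).
  by rewrite le_eqVlt; apply/orP; left; apply/eqP; field; rewrite gt_eqF.
apply: (@le_trans _ _ _ _ _ (ler_wpM2l (sqr_ge0 _) H)).
rewrite mulr_sumr big_nat_cond [leRHS]big_nat_cond.
apply: ler_sum => i; rewrite andbT => imn.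
rewrite (step_fourier _ L0 Hf fE) mulrCA; apply: ler_wpM2l.
  have := wS i ltac:(nlia); have := wS i.+1 ltac:(nlia); rewrite /midpoint; lra.
rewrite ler_wpM2r ?addr_ge0 ?sqr_ge0// ler_pXn2r ?nnegrE//.
- by rewrite ler_pM2r ?invr_gt0// cell_factor_ge// wy.
- by rewrite divr_ge0// ltW.
- by rewrite divr_ge0 ?(ltW LR)// (le_trans s0)// cell_factor_ge// wy.
Qed.

End StepFunctions.

(** * From sampling bounds to the constant C *)

Section ConditionNumber.
Context {R : realType}.
Implicit Types (K delta : R) (N M : nat) (w : nat -> R) (f : R -> R[i]) (T : set (R -> R[i])).

(** Samples outside the window from [m] to [n] have nonnegative terms and are dropped. *)
Lemma rayleigh_lower K delta N w f (L m n : nat) (p q : nat -> R) (y : R) :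
  Kdelta_dense K delta N w -> (0 < L)%N -> Hspace f -> 0 < norm2 f -> step_on L p q f ->
  (m <= n <= N)%N -> midpoint (wext K N w) m + L%:R <= midpoint (wext K N w) n ->
  0 < y <= pi ->
  (forall i, (m <= i < n)%N -> `|pi * wext K N w i.+1 / L%:R| <= y) ->
  sinc y ^+ 2 * (1 - delta) ^+ 2 <= rayleigh K N w f.
Proof.
move=> Kd L0 Hf nf fE mnN zmn y01 wy; rewrite rayleighE// ler_pdivlMr//.
apply: (le_trans (step_sampling_lower L0 Hf fE Kd mnN zmn y01 wy)).
have /andP[mn nN] := mnN; have wS := dense_wext_le Kd.
pose F i := (midpoint (wext K N w) i.+1 - midpoint (wext K N w) i) *
    cabs2 (fourier f (wext K N w i.+1)).
have F0 a b : (b <= N)%N -> 0 <= \sum_(a <= i < b) F i.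
  move=> bN; rewrite big_nat_cond sumr_ge0// => i; rewrite andbT => /andP[_ ib].
  apply: mulr_ge0; last by rewrite /cabs2 addr_ge0 ?sqr_ge0.
  have := wS i ltac:(nlia); have := wS i.+1 ltac:(nlia); rewrite /midpoint; lra.
rewrite -/(F _) [leRHS](@big_cat_nat _ _ _ m)//=; last exact: leq_trans mn nN.
rewrite [X in _ <= _ + X](@big_cat_nat _ _ _ n)//=.
have := F0 0%N m (leq_trans mn nN); have := F0 n N (leqnn N); rewrite /F; lra.
Qed.

Lemma Cconst_le_lower K delta N w M T (s : R) :
  Kdelta_dense K delta N w -> (0 < M)%N -> nonzero_subspace_of (UM M) T -> 0 < s ->
  (forall f, UM M f -> 0 < norm2 f -> s ^+ 2 * (1 - delta) ^+ 2 <= rayleigh K N w f) ->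
  Cconst_le K N w T (s^-1 * ((1 + delta) / (1 - delta))).
Proof.
move=> Kd M0 [TU [_ [_ [_ [g [Tg ng]]]]]] s0 low.
have [_ [/andP[d0 d1] _]] := Kd.
have a0 : 0 < 1 - delta by rewrite subr_gt0.
set l := s ^+ 2 * (1 - delta) ^+ 2; set u := (1 + delta) ^+ 2.
have l0 : 0 < l by rewrite mulr_gt0// exprn_gt0.
have C1 : (l%:E <= Cone K N w T)%E.
  by apply: le_ereal_inf_tmp => _ [f [Tf nf] <-]; rewrite lee_fin; apply: low => //; exact: TU.
(* The nonzero element [g] rules out an infimum of +oo and a supremum of -oo, so [fine] returns the
   true values. *)
have C1g : (Cone K N w T <= (rayleigh K N w g)%:E)%E.
  by apply: ereal_inf_lbound; exists g.
have C2 : (Ctwo K N w <= u%:E)%E.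
  by apply: ge_ereal_sup => _ [f [Hf nf] <-]; rewrite lee_fin; exact: rayleigh_upper Kd Hf nf.
have C2g : ((rayleigh K N w g)%:E <= Ctwo K N w)%E.
  by apply: ereal_sup_ubound; exists g => //; split => //; exact: UM_Hspace (TU g Tg).
have lg : l <= rayleigh K N w g by apply: low => //; exact: TU.
split; first by apply: lt_le_trans C1; rewrite lte_fin.
split; first by apply: le_lt_trans C2 _; rewrite ltry.
move: C1 C1g C2 C2g; case: (Cone K N w T) => [c1| |] //; case: (Ctwo K N w) => [c2| |] //.
rewrite !lee_fin /= => lc1 _ c2u gc2.
have c10 : 0 < c1 by exact: lt_le_trans lc1.
have -> : s^-1 * ((1 + delta) / (1 - delta)) = Num.sqrt (u / l).
  rewrite /u /l -exprMn -expr_div_n sqrtr_sqr ger0_norm; last first.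
    by rewrite divr_ge0//; [lra|rewrite mulr_ge0 ?ltW].
  by field; rewrite !gt_eqF.
rewrite ler_wsqrtr// ler_pM ?invr_ge0 ?(ltW c10)//; last by rewrite lef_pV2.
by apply: le_trans gc2; apply: le_trans lg; exact: ltW.
Qed.

Lemma wext_mono K delta N w : Kdelta_dense K delta N w ->
  forall i j, (i <= j <= N.+1)%N -> wext K N w i <= wext K N w j.
Proof.
move=> /dense_wext_le wS i j /andP[]; elim: j => [|j IHj].
  by rewrite leqn0 => /eqP->.
rewrite leq_eqVlt => /predU1P[->//|]; rewrite ltnS => ij jN.
exact: le_trans (IHj ij (ltnW jN)) (wS j jN).
Qed.

(** The window consists of the samples in [-B, B] with B = M/2 + delta; [m.+1] is the first such
    index, as cell [m] belongs to sample [m.+1]. *)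
Lemma dense_window K delta N w M : Kdelta_dense K delta N w -> M%:R <= 2 * K ->
  exists m n, [/\ (m <= n <= N)%N,
    midpoint (wext K N w) m + M%:R <= midpoint (wext K N w) n &
    forall i, (m <= i < n)%N -> `|wext K N w i.+1| <= M%:R / 2 + delta].
Proof.
move=> Kd MK; have [K0 [/andP[d0 d1] [N0 [_ [wK wd]]]]] := Kd.
have wm := wext_mono Kd; set W := wext K N w in wd wm *.
have [/andP[w1 w1'] /andP[wN wN']] : (- K <= w 1%N <= K) /\ (- K <= w N <= K).
  by split; apply: wK; nlia.
have W0 : W 0%N = w N - 2 * K by [].
have WS : W N.+1 = w 1%N + 2 * K by rewrite /W /wext eqxx.
have W1 : W 1%N = w 1%N by exact: wext_in.
have WN : W N = w N by case: N N0 @W {wd wm wN wN' W0 WS W1 wK Kd} => // N' _ W; exact: wext_in.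
have M0 : (0 : R) <= M%:R by rewrite ler0n.
set B := M%:R / 2 + delta.
have exm : exists m, - B <= W m.+1 by exists N; rewrite WS /B; lra.
case: (ex_minnP exm) => m mB mmin.
have exn : exists n, (n <= N)%N && (W n <= B) by exists 0%N; rewrite W0 /B /=; lra.
have bnd n : (n <= N)%N && (W n <= B) -> (n <= N)%N by case/andP.
case: (ex_maxnP exn bnd) => n /andP[nN nB] nmax.
have mN : (m <= N)%N by apply: mmin; rewrite WS /B; lra.
have zm : m = 0%N \/ W m < - B.
  case: m {mB mN} mmin => [|m] mmin; [by left|right].
  by rewrite ltNge; apply/negP => /mmin; rewrite ltnn.
have zn : n = N \/ (n < N)%N /\ B < W n.+1.
  move: nN; rewrite leq_eqVlt => /predU1P[->|nN]; [by left|right; split => //].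
  by rewrite ltNge; apply/negP => h; have := nmax n.+1; rewrite nN h ltnn => /(_ isT).
have dm := wd m mN; have dn := wd n nN; have dz := wd 0%N (leq0n N).
exists m, n; split.
- rewrite nN andbT leqNgt; apply/negP => nm.
  have [nE|[_ Wn]] := zn; first by rewrite nE ltnNge mN in nm.
  have [mE|Wm] := zm; first by rewrite mE in nm.
  by have := wm n.+1 m; rewrite nm (leqW mN) => /(_ isT); rewrite /B in Wn Wm *; lra.
- rewrite /midpoint -/W.
  move: dm dn dz zn zm; rewrite /B => dm dn dz.
  (* A midpoint next to a sample beyond B in modulus exceeds M/2 by delta/2 on its side; one at an
     extended end falls short of M/2 by at most delta/2. Two extended ends are exactly 2K apart. *)
  by move=> [->|[_ Wn]] [->|Wm]; move: dz; rewrite ?WN ?WS ?W0 ?W1; lra.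
- move=> i /andP[mi iN]; rewrite ler_norml; apply/andP; split.
    by apply: (le_trans mB); apply: wm; nlia.
  by apply: le_trans nB; apply: wm; nlia.
Qed.

Lemma cvg_c0 delta : (fun m : nat => c0 delta m) @ \oo --> (pi / 2 : R).
Proof.
rewrite -cvg_shiftS /=.
have p0 : (pi : R) != 0 by rewrite gt_eqF// pi_gt0.
have hN : (fun n => pi / 2 + pi * delta / n.+1%:R) @ \oo --> (pi / 2 : R).
  rewrite -[X in _ --> X]addr0 -[X in _ --> _ + X](mulr0 (pi * delta)).
  apply: cvgD; first exact: cvg_cst.
  by apply: cvgM; [exact: cvg_cst|exact: cvg_harmonic].
have -> : (pi / 2 : R) = (sin (pi / 2) * (pi / 2)^-1)^-1.
  by rewrite sin_pihalf mul1r invrK.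
rewrite /c0 /sinc; apply: cvgV.
  by rewrite sin_pihalf mul1r invr_eq0 mulf_neq0.
apply: cvgM; first exact: (cvg_comp _ _ hN (@continuous_sin R (pi / 2))).
by apply: cvgV => //; rewrite mulf_neq0.
Qed.

End ConditionNumber.

Theorem theorem5p7 (R : realType) (K delta : R) (N : nat) (w : nat -> R)
    (M : nat) (T : set (R -> R[i])) :
  Kdelta_dense K delta N w ->
  (0 < M)%N ->
  M%:R <= 2 * K ->
  nonzero_subspace_of (UM M) T ->
  ((exists k : nat, 2 * K / M%:R = k%:R) ->
     Cconst_le K N w T (pi / 2 * ((1 + delta) / (1 - delta)))) /\
  (~ (exists k : nat, 2 * K / M%:R = k%:R) -> (2 <= M)%N ->
     Cconst_le K N w T (c0 delta M * ((1 + delta) / (1 - delta)))) /\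
  ((fun m : nat => c0 delta m) @ \oo --> (pi / 2 : R)).
Proof.
move=> Kd M0 MK TU; have p0 := pi_gt0 R.
have [K0 [/andP[d0 d1] [N0 [_ [wK _]]]]] := Kd.
have MR : (0 : R) < M%:R by rewrite ltr0n.
split; [|split; last exact: cvg_c0].
- move=> [k kE].
  (* With L = k M = 2K all the cells together form exactly one period, and |w| <= K gives |pi w / L|
     <= pi/2. *)
  have KE : 2 * K = (k * M)%:R by rewrite natrM -kE divfK// gt_eqF.
  have k0 : (0 < k)%N by rewrite -(ltr0n R) -kE divr_gt0// mulr_gt0.
  have sE : (pi / 2 : R) = (sinc (pi / 2))^-1.
    by rewrite /sinc sin_pihalf mul1r invrK.
  rewrite {1}sE; apply: (Cconst_le_lower Kd M0 TU).
    by rewrite /sinc sin_pihalf mul1r invr_gt0 divr_gt0.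
  move=> f Uf nf; have [p [q fE]] := UM_step M0 k0 Uf.
  have L0 : (0 < k * M)%N by rewrite muln_gt0 k0.
  apply: (rayleigh_lower Kd L0 (UM_Hspace M0 Uf) nf fE (m := 0%N) (n := N)).
  + by rewrite leqnn.
  + have W0 : wext K N w 0%N = w N - 2 * K by [].
    have WS : wext K N w N.+1 = w 1%N + 2 * K by rewrite /wext eqxx.
    have WN : wext K N w N = w N by rewrite /wext (gtn_eqF N0) (ltn_eqF (ltnSn N)).
    by rewrite -KE /midpoint W0 WS WN wext_in//; lra.
  + by apply/andP; split; lra.
  + move=> i /andP[_ iN]; rewrite wext_in// -KE normrM normrM normfV.
    rewrite (gtr0_norm p0) (@gtr0_norm _ (2 * K)) ?mulr_gt0//.
    have := wK i.+1; rewrite iN /= -ler_norml => /(_ isT) h.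
    rewrite ler_pdivrMr ?mulr_gt0//.
    have -> : pi / 2 * (2 * K) = pi * K by lra.
    by rewrite ler_pM2l.
- move=> _ M2; have M2R : (2 : R) <= M%:R by rewrite ler_nat.
  (* Here L = M, and [y] is pi w / M at the window edge w = M/2 + delta; it stays below pi because
     delta < 1 and M >= 2. *)
  set y := pi / 2 + pi * delta / M%:R.
  have y0 : pi / 2 < y by rewrite ltrDl divr_gt0// mulr_gt0.
  have ypi : y < pi.
    suff : pi * delta / M%:R < pi / 2 by rewrite /y; lra.
    rewrite ltr_pdivrMr//.
    have : (pi / 2 : R) * 2 <= pi / 2 * M%:R by rewrite ler_pM2l// divr_gt0.
    have : pi * delta < pi * 1 by rewrite ltr_pM2l.
    lra.
  have ygt0 : 0 < y by apply: lt_trans y0; rewrite divr_gt0.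
  apply: (Cconst_le_lower Kd M0 TU).
    by apply: divr_gt0 => //; apply: sin_gt0_pi; rewrite ygt0.
  move=> f Uf nf; have [p [q fE]] := UM_step M0 (ltn0Sn 0) Uf; rewrite mul1n in fE.
  have [m [n [mn zmn wb]]] := dense_window Kd MK.
  apply: (rayleigh_lower Kd M0 (UM_Hspace M0 Uf) nf fE mn zmn).
    by rewrite ygt0 ltW.
  move=> i /wb wi; rewrite normrM normrM normfV (gtr0_norm p0) (gtr0_norm MR).
  rewrite ler_pdivrMr// /y; have -> : (pi / 2 + pi * delta / M%:R) * M%:R =
    pi * (M%:R / 2 + delta) by gen_pi; field; rewrite gt_eqF.
  by rewrite ler_pM2l.
Qed.
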